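(* Let $p,q,r\geq2$ be integers with $\frac1p+\frac1q+\frac1r\leq1$, and let $$\Gamma=\langle a,b,c\mid a^2=b^2=c^2=(ab)^p=(bc)^q=(ca)^r=1\rangle$$ be the corresponding Coxeter triangle group. Then for any prime $\ell>2$, the mod $\ell$ homology of $\Gamma$ is given as the direct sum over the mod $\ell$ homology of the dihedral groups $\mathcal{D}_p$, $\mathcal{D}_q$ and $\mathcal{D}_r$: $$\operatorname{H}_n(\Gamma;\mathbb{Z}/\ell)\cong\operatorname{H}_n(\mathcal{D}_p;\mathbb{Z}/\ell)\oplus\operatorname{H}_n(\mathcal{D}_q;\mathbb{Z}/\ell)\oplus\operatorname{H}_n(\mathcal{D}_r;\mathbb{Z}/\ell).$$
   Context: $\mathcal{D}_k$ denotes the dihedral group of order $2k$. Mod $\ell$ homology is group homology with $\mathbb{Z}/\ell$-coefficients under the trivial action.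
   Formalization: The isomorphism is stated for n ≥ 1 only: in degree n = 0 it fails for every such Γ, since H_0(Γ; Z/ℓ) = Z/ℓ while the right-hand side is (Z/ℓ)^3. *)

(* Defs.v *)
From HB Require Import structures.
From mathcomp.multinomials Require Import freeg.
From mathcomp Require Import all_boot all_order all_algebra all_fingroup all_solvable.
From mathcomp Require Import generic_quotient boolp.

Set Implicit Arguments.
Unset Strict Implicit.
Unset Printing Implicit Defensive.

Import GRing.Theory.

(** * Groups given by generators and relators *)

Section Presentation.
Variable X : choiceType.

(* The letter (x, false) stands for the generator x, (x, true) for its inverse. *)
Definition word := seq (X * bool).

Definition word_inv (w : word) : word := rev [seq (l.1, ~~ l.2) | l <- w].

Variable rels : seq word.

(* Least congruence on words that cancels inverse letters and kills relators. *)
Inductive word_congr : word -> word -> Prop :=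
| WRefl u : word_congr u u
| WSym u v : word_congr u v -> word_congr v u
| WTrans u v w : word_congr u v -> word_congr v w -> word_congr u w
| WCat u u' v v' :
    word_congr u u' -> word_congr v v' -> word_congr (u ++ v) (u' ++ v')
| WCancel x b : word_congr [:: (x, b); (x, ~~ b)] [::]
| WRel r : r \in rels -> word_congr r [::].

Definition word_equiv (u v : word) : bool := `[< word_congr u v >].

Lemma word_equiv_refl : reflexive word_equiv.
Proof. by move=> u; apply/asboolP; exact: WRefl. Qed.

Lemma word_equiv_sym : symmetric word_equiv.
Proof. by move=> u v; apply/asboolP/asboolP; exact: WSym. Qed.

Lemma word_equiv_trans : transitive word_equiv.
Proof.
by move=> v u w /asboolP uv /asboolP vw; apply/asboolP; exact: WTrans uv vw.
Qed.

Canonical word_equiv_rel :=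
  EquivRel word_equiv word_equiv_refl word_equiv_sym word_equiv_trans.
Canonical word_equiv_direct := defaultEncModRel word_equiv.

Definition presented := {eq_quot word_equiv}%qT.

HB.instance Definition _ := Quotient.on presented.
HB.instance Definition _ := Choice.on presented.
HB.instance Definition _ : EqQuotient _ word_equiv presented :=
  EqQuotient.on presented.

Local Open Scope quotient_scope.

Definition presented_one : presented := \pi_presented [::].
Definition presented_mul (g h : presented) : presented := \pi_presented (repr g ++ repr h).
Definition presented_inv (g : presented) : presented := \pi_presented (word_inv (repr g)).

Lemma presented_eqP (u v : word) :
  \pi_presented u = \pi v <-> word_congr u v.
Proof.
split=> [/eqmodP/asboolP // | uv].
by apply/eqmodP/asboolP.
Qed.

Lemma repr_presented (u : word) : word_congr (repr (\pi_presented u)) u.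
Proof. by apply/presented_eqP; rewrite reprK. Qed.

Lemma word_inv_cons l w : word_inv (l :: w) = rcons (word_inv w) (l.1, ~~ l.2).
Proof. by rewrite /word_inv /= rev_cons. Qed.

Lemma word_mulV w : word_congr (w ++ word_inv w) [::].
Proof.
elim: w => [|[x b] w IH]; first exact: WRefl.
have -> : ((x, b) :: w) ++ word_inv ((x, b) :: w)
    = [:: (x, b)] ++ ((w ++ word_inv w) ++ [:: (x, ~~ b)]).
  by rewrite word_inv_cons -cats1 /= catA.
apply: WTrans (WCancel x b).
apply: (@WCat _ [:: (x, b)] _ ([::] ++ [:: (x, ~~ b)])); first exact: WRefl.
by apply: WCat => //; exact: WRefl.
Qed.

Lemma word_invK : involutive word_inv.
Proof.
move=> w; rewrite /word_inv map_rev revK -map_comp -[RHS]map_id.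
by apply: eq_map => -[x b] /=; rewrite negbK.
Qed.

Lemma word_mulVw w : word_congr (word_inv w ++ w) [::].
Proof. by have := word_mulV (word_inv w); rewrite word_invK. Qed.

Lemma presented_mulA : associative presented_mul.
Proof.
move=> g h k; apply/presented_eqP.
apply: (@WTrans _ (repr g ++ (repr h ++ repr k))).
  by apply: WCat (repr_presented _); exact: WRefl.
rewrite catA; apply: WCat; last exact: WRefl.
by apply: WSym; exact: repr_presented.
Qed.

Lemma presented_mul1 : left_id presented_one presented_mul.
Proof.
move=> g; rewrite -[RHS]reprK; apply/presented_eqP.
rewrite -[X in word_congr _ X]/([::] ++ _).
by apply: WCat; [exact: repr_presented | exact: WRefl].
Qed.

Lemma presented_1mul : right_id presented_one presented_mul.
Proof.
move=> g; rewrite -[RHS]reprK; apply/presented_eqP.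
rewrite -[X in word_congr _ X]cats0.
by apply: WCat; [exact: WRefl | exact: repr_presented].
Qed.

Lemma presented_mulV : left_inverse presented_one presented_inv presented_mul.
Proof.
move=> g; apply/presented_eqP; apply: WTrans (word_mulVw (repr g)).
by apply: WCat; [exact: repr_presented | exact: WRefl].
Qed.

Lemma presented_Vmul : right_inverse presented_one presented_inv presented_mul.
Proof.
move=> g; apply/presented_eqP; apply: WTrans (word_mulV (repr g)).
by apply: WCat; [exact: WRefl | exact: repr_presented].
Qed.

HB.instance Definition _ := isGroup.Build presented
  presented_mulA presented_mul1 presented_1mul presented_mulV presented_Vmul.

End Presentation.

(** * Coxeter triangle groups and dihedral groups *)

Definition word_exp (X : choiceType) (w : word X) (k : nat) : word X :=
  flatten (nseq k w).

Definition triangle_rels (p q r : nat) : seq (word 'I_3) :=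
  let a : word 'I_3 := [:: (inord 0, false)] in
  let b : word 'I_3 := [:: (inord 1, false)] in
  let c : word 'I_3 := [:: (inord 2, false)] in
  [:: word_exp a 2; word_exp b 2; word_exp c 2;
      word_exp (a ++ b) p; word_exp (b ++ c) q; word_exp (c ++ a) r].

Definition triangle_group (p q r : nat) : groupType :=
  presented (triangle_rels p q r).

(* 'D_m is the library's dihedral group of order m (m even, m >= 4). *)
Definition dihedral_group (k : nat) : groupType := 'D_(k.*2)%type.

(** * Subquotients of modules *)

Local Open Scope ring_scope.

Section QuotientModule.
Variables (R : nzRingType) (V : lmodType R) (W : submodClosed V).

Lemma submodN (x : V) : (- x \in W) = (x \in W).
Proof.
suff NW y : y \in W -> - y \in W by apply/idP/idP => /NW //; rewrite opprK.
by move=> Wy; rewrite -scaleN1r rpredZ.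
Qed.

Definition quot_equiv (x y : V) : bool := x - y \in W.

Lemma quot_equiv_refl : reflexive quot_equiv.
Proof. by move=> x; rewrite /quot_equiv subrr rpred0. Qed.

Lemma quot_equiv_sym : symmetric quot_equiv.
Proof. by move=> x y; rewrite /quot_equiv -opprB submodN. Qed.

Lemma quot_equiv_trans : transitive quot_equiv.
Proof.
move=> y x z xy yz; rewrite /quot_equiv.
by rewrite -[x](subrK y) -addrA rpredD.
Qed.

Canonical quot_equiv_rel :=
  EquivRel quot_equiv quot_equiv_refl quot_equiv_sym quot_equiv_trans.
Canonical quot_equiv_direct := defaultEncModRel quot_equiv.

Definition quot_mod := {eq_quot quot_equiv}%qT.

HB.instance Definition _ := Quotient.on quot_mod.
HB.instance Definition _ := Choice.on quot_mod.
HB.instance Definition _ : EqQuotient _ quot_equiv quot_mod :=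
  EqQuotient.on quot_mod.

Local Open Scope quotient_scope.

Definition quot_zero : quot_mod := \pi_quot_mod 0.
Definition quot_opp (x : quot_mod) : quot_mod := \pi_quot_mod (- repr x).
Definition quot_add (x y : quot_mod) : quot_mod := \pi_quot_mod (repr x + repr y).
Definition quot_scale (a : R) (x : quot_mod) : quot_mod := \pi_quot_mod (a *: repr x).

Lemma quot_eqP (x y : V) : \pi_quot_mod x = \pi y <-> x - y \in W.
Proof. by split=> [/eqmodP | ?]; last apply/eqmodP. Qed.

Lemma repr_quot (x : V) : repr (\pi_quot_mod x) - x \in W.
Proof. by apply/quot_eqP; rewrite reprK. Qed.

Lemma quot_addE (x y : V) : quot_add (\pi_quot_mod x) (\pi_quot_mod y) = \pi_quot_mod (x + y).
Proof. by apply/quot_eqP; rewrite opprD addrACA rpredD ?repr_quot. Qed.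

Lemma quot_oppE (x : V) : quot_opp (\pi_quot_mod x) = \pi_quot_mod (- x).
Proof. by apply/quot_eqP; rewrite -opprD submodN repr_quot. Qed.

Lemma quot_scaleE a (x : V) :
  quot_scale a (\pi_quot_mod x) = \pi_quot_mod (a *: x).
Proof. by apply/quot_eqP; rewrite -scalerBr rpredZ ?repr_quot. Qed.

Lemma quot_addA : associative quot_add.
Proof.
move=> x y z; elim/quotW: x => x; elim/quotW: y => y; elim/quotW: z => z.
by rewrite (quot_addE y z) (quot_addE x y) !quot_addE addrA.
Qed.

Lemma quot_addC : commutative quot_add.
Proof.
move=> x y; elim/quotW: x => x; elim/quotW: y => y.
by rewrite !quot_addE addrC.
Qed.

Lemma quot_add0 : left_id quot_zero quot_add.
Proof. by move=> x; elim/quotW: x => x; rewrite quot_addE add0r. Qed.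

Lemma quot_addN : left_inverse quot_zero quot_opp quot_add.
Proof. by move=> x; elim/quotW: x => x; rewrite quot_oppE quot_addE addNr. Qed.

HB.instance Definition _ := GRing.isZmodule.Build quot_mod
  quot_addA quot_addC quot_add0 quot_addN.

Lemma quot_piD (x y : V) :
  \pi_quot_mod x + \pi_quot_mod y = \pi_quot_mod (x + y).
Proof. exact: quot_addE. Qed.

Lemma quot_scaleA a b x : quot_scale a (quot_scale b x) = quot_scale (a * b) x.
Proof. by elim/quotW: x => x; rewrite (quot_scaleE b) !quot_scaleE scalerA. Qed.

Lemma quot_scale1 : left_id 1 quot_scale.
Proof. by move=> x; elim/quotW: x => x; rewrite quot_scaleE scale1r. Qed.

Lemma quot_scaleDr : right_distributive quot_scale +%R.
Proof.
move=> a x y; elim/quotW: x => x; elim/quotW: y => y.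
rewrite quot_piD (quot_scaleE a x) (quot_scaleE a y) quot_piD.
by rewrite quot_scaleE scalerDr.
Qed.

Lemma quot_scaleDl x : {morph quot_scale^~ x : a b / a + b}.
Proof.
elim/quotW: x => x a b; rewrite (quot_scaleE a) (quot_scaleE b) quot_piD.
by rewrite quot_scaleE scalerDl.
Qed.

HB.instance Definition _ := GRing.Zmodule_isLmodule.Build R quot_mod
  quot_scaleA quot_scale1 quot_scaleDr quot_scaleDl.

End QuotientModule.

Section Homology.
Variables (R : nzRingType) (U V W : lmodType R).
Variables (f : {linear U -> V}) (g : {linear V -> W}).

Definition ker_pred : {pred V} := [pred v | g v == 0].

Lemma ker_closed : submod_closed ker_pred.
Proof.
split=> [|a u v]; rewrite !inE ?linear0 // => /eqP gu /eqP gv.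
by rewrite linearP gu gv scaler0 addr0.
Qed.

HB.instance Definition _ := GRing.isSubmodClosed.Build R V ker_pred
  ker_closed.

Record kernel := Kernel { ker_val :> V; ker_valP : ker_val \in ker_pred }.

HB.instance Definition _ := [isSub for ker_val].
HB.instance Definition _ := [Choice of kernel by <:].
HB.instance Definition _ := [SubChoice_isSubZmodule of kernel by <:].
HB.instance Definition _ := [SubZmodule_isSubLmodule of kernel by <:].

Definition boundary_pred : {pred kernel} :=
  [pred z : kernel | `[< exists u, f u = val z >]].

Lemma boundary_closed : submod_closed boundary_pred.
Proof.
split=> [|a x y]; rewrite !inE.
  by apply/asboolP; exists 0; rewrite linear0.
move=> /asboolP[u fu] /asboolP[v fv]; apply/asboolP; exists (a *: u + v).
by rewrite linearP fu fv.
Qed.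

HB.instance Definition _ := GRing.isSubmodClosed.Build R kernel boundary_pred
  boundary_closed.

(* For f : U -> V and g : V -> W, the module ker g / im f (f is only used when
   g \o f = 0, so that im f is contained in ker g). *)
Definition homology_at : lmodType R := quot_mod boundary_pred.

End Homology.

(** * Group homology, via the inhomogeneous bar complex *)

Section GroupHomology.
Variables (R : nzRingType) (G : groupType).

(* R (x)_{Z[G]} B_n, with B_n the bar resolution and R a trivial G-module: the
   free R-module on the symbols [g_1 | ... | g_n]. *)
Definition bar_chain (n : nat) : lmodType R := {freeg (n.-tuple G) / R}.

(* The i-th face of [g_1 | ... | g_{n+1}] drops g_1 (i = 0), drops g_{n+1}
   (i = n + 1), or replaces g_i, g_{i+1} by their product. *)
Definition bar_face n (i : 'I_n.+2) (g : n.+1.-tuple G) : n.-tuple G :=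
  [tuple let x := tnth g (widen_ord (leqnSn n) j) in
         let y := tnth g (lift ord0 j) in
         if (j.+1 < i)%N then x else if j.+1 == i then (x * y)%g else y
  | j < n].

Definition bar_symbol n (g : n.-tuple G) : bar_chain n := Freeg [:: (1, g)].

Definition bar_diff n : bar_chain n.+1 -> bar_chain n :=
  fglift (fun g => \sum_(i < n.+2) (-1) ^+ i *: bar_symbol (bar_face i g)).

Lemma bar_diffE n (g : n.+1.-tuple G) :
  bar_diff (bar_symbol g) =
  \sum_(i < n.+2) (-1) ^+ i *: bar_symbol (bar_face i g).
Proof. by rewrite /bar_diff liftU scale1r. Qed.

Lemma bar_chain_ind n (P : bar_chain n -> Prop) :
  P 0 -> (forall a g c, P c -> P (a *: bar_symbol g + c)) -> forall c, P c.
Proof.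
move=> P0 PD c; rewrite -[c]freeg_sumE.
elim: (freeg.dom c) => [|g s IH]; first by rewrite big_nil.
rewrite big_cons.
have -> : Freeg [:: (coeff g c, g)] = coeff g c *: bar_symbol g.
  by apply/eqP/freeg_eqP => h; rewrite coeffZ !coeffU mul1r.
exact: PD.
Qed.

Lemma bar_diff_linear n : linear (@bar_diff n).
Proof.
have bD : additive (@bar_diff n) by exact: lift_is_additive.
have b0 : bar_diff (0 : bar_chain n.+1) = 0.
  by rewrite -[0 in LHS](subrr 0) bD subrr.
have bN u : bar_diff (- u : bar_chain n.+1) = - bar_diff u.
  by rewrite -[- u]add0r bD b0 add0r.
have bA u v : bar_diff (u + v : bar_chain n.+1) = bar_diff u + bar_diff v.
  by rewrite -[v in LHS]opprK bD bN opprK.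
have bZ a u : bar_diff (a *: u : bar_chain n.+1) = a *: bar_diff u.
  elim/bar_chain_ind: u => [|b g u IH]; first by rewrite scaler0 b0 scaler0.
  rewrite scalerDr !bA IH scalerDr scalerA; congr (_ + _).
  have E c : bar_diff (c *: bar_symbol g) = c *: bar_diff (bar_symbol g).
    have -> : c *: bar_symbol g = Freeg [:: (c, g)].
      by apply/eqP/freeg_eqP => h; rewrite coeffZ !coeffU mul1r.
    by rewrite /bar_diff !liftU scale1r.
  by rewrite !E scalerA.
by move=> a u v; rewrite bA bZ.
Qed.

HB.instance Definition _ n := GRing.isLinear.Build R (bar_chain n.+1)
  (bar_chain n) _ (@bar_diff n) (@bar_diff_linear n).

Lemma bar_faceE n (i : 'I_n.+2) (g : n.+1.-tuple G) (k : 'I_n) :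
  tnth (bar_face i g) k =
  (if (k.+1 < i)%N then nth 1%g g k
   else if k.+1 == i then (nth 1%g g k * nth 1%g g k.+1)%g
   else nth 1%g g k.+1).
Proof. by rewrite tnth_mktuple !(tnth_nth 1%g). Qed.

Lemma bar_face_face n (i : 'I_n.+3) (j j' : 'I_n.+2) (i' : 'I_n.+3)
    (g : n.+2.-tuple G) :
  (j < i)%N -> i' = j :> nat -> i = j'.+1 :> nat ->
  bar_face j (bar_face i g) = bar_face j' (bar_face i' g).
Proof.
move=> lt_ji Ei' Ej'; apply/eq_from_tnth => k.
have lt_k : (k < n)%N by [].
have lt_k1 : (k < n.+1)%N by exact: ltnW.
have nthE (e : 'I_n.+3) m : (m < n.+1)%N -> nth 1%g (bar_face e g) m =
    (if (m.+1 < e)%N then nth 1%g g m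
     else if m.+1 == e then (nth 1%g g m * nth 1%g g m.+1)%g
     else nth 1%g g m.+1).
  by move=> lt_m; rewrite -(tnth_nth _ _ (Ordinal lt_m)) bar_faceE.
rewrite !bar_faceE !nthE // Ei' Ej'.
have le_jj' : (j <= j')%N by rewrite -ltnS -Ej'.
rewrite !ltnS !eqSS; case: (ltngtP k.+1 j) => [lt1|gt1|eq1].
- by rewrite (leq_trans lt1 le_jj') (ltnW (leq_trans lt1 le_jj')).
- by rewrite (gtn_eqF (leqW gt1)) (leq_gtF (leqW (ltnW gt1))).
- rewrite -eq1 in le_jj' *.
  rewrite le_jj' (leq_gtF (leqnSn k.+1)) (gtn_eqF (ltnSn k.+1)).
  case: (ltngtP k.+1 j') => //; last by rewrite mulgA.
  by rewrite ltnNge le_jj'.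
Qed.

Lemma bar_diffK n (c : bar_chain n.+2) : bar_diff (bar_diff c) = 0.
Proof.
elim/bar_chain_ind: c => [|a g c IH]; first by rewrite !linear0.
rewrite !linearP /= IH addr0 bar_diffE linear_sum /=.
set F := fun i : 'I_n.+3 => fun j : 'I_n.+2 =>
  (-1) ^+ (i + j) *: bar_symbol (bar_face j (bar_face i g)) : bar_chain n.
have -> : \sum_(i < n.+3) bar_diff ((-1) ^+ i *: bar_symbol (bar_face i g))
    = \sum_(i < n.+3) \sum_(j < n.+2) F i j.
  apply: eq_bigr => i _; rewrite linearZ /= bar_diffE scaler_sumr.
  by apply: eq_bigr => j _; rewrite /F scalerA exprD.
rewrite pair_bigA /= (bigID (fun ij : 'I_n.+3 * 'I_n.+2 => ij.2 < ij.1)%N) /=.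
pose h (ij : 'I_n.+3 * 'I_n.+2) : 'I_n.+3 * 'I_n.+2 :=
  (lift ord0 ij.2, inord ij.1).
pose h' (ij : 'I_n.+3 * 'I_n.+2) : 'I_n.+3 * 'I_n.+2 :=
  (widen_ord (leqnSn _) ij.2, inord ij.1.-1).
rewrite (reindex_onto h h') => [|[i j] /= lt_ji]; last first.
  have i_gt0 : (0 < i)%N by exact: leq_ltn_trans lt_ji.
  have lt_i : (i.-1 < n.+2)%N by rewrite -ltnS prednK.
  congr (_, _); apply/val_inj => /=; last by rewrite inordK.
  by rewrite /= inordK // /bump /= add1n prednK.
have Eh : (fun ij => ((h ij).2 < (h ij).1)%N && (h' (h ij) == ij))
    =1 (fun ij : 'I_n.+3 * 'I_n.+2 => ~~ (ij.2 < ij.1)%N).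
  case=> i j /=; rewrite -leqNgt /bump /= add1n ltnS.
  have Ej : inord (lift ord0 j).-1 = j :> 'I_n.+2.
    by apply/val_inj; rewrite lift0 /= inordK.
  rewrite /h' /h /= xpair_eqE Ej eqxx andbT.
  apply/andP/idP => [[le_ij /eqP/(congr1 val) /=]|le_ij].
    by move: le_ij => + <-.
  have lt_i : (i < n.+2)%N by exact: leq_ltn_trans le_ij _.
  by split; [rewrite inordK | apply/eqP/val_inj; rewrite /= inordK].
rewrite (eq_bigl _ _ Eh) -big_split /= big1 ?scaler0 // => -[i j] /=.
rewrite -leqNgt => le_ij; rewrite /F /=.
have lt_i : (i < n.+2)%N by exact: leq_ltn_trans le_ij _.
rewrite (@bar_face_face n (lift ord0 j) (inord i) j i) //=; last first.
- by rewrite inordK.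
- by rewrite inordK // /bump /= add1n ltnS.
by rewrite inordK // /bump /= add1n addSn exprS mulN1r scaleNr addnC addNr.
Qed.

Definition group_homology (n : nat) : lmodType R :=
  if n is m.+1 then homology_at (@bar_diff m.+1) (@bar_diff m)
  else homology_at (@bar_diff 0) (\0 : bar_chain 0 -> bar_chain 0).

End GroupHomology.

(* Main.v *)
From HB Require Import structures.
Require Import Defs.
From mathcomp.multinomials Require Import freeg.
From mathcomp Require Import all_boot all_order all_algebra.
From mathcomp Require Import ring zify all_fingroup all_solvable all_field.
From mathcomp Require Import generic_quotient boolp.

(** Write G for the triangle group and D1, D2, D3 for its subgroups generated by
    (a, b), (b, c), (c, a).  G acts on its Coxeter complex, whose triangles, edges
    and vertices are the cosets of 1, of the subgroups generated by one
    reflection, and of the D_i.  When 1/p + 1/q + 1/r <= 1 this complex is a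
    triangulated plane, hence acyclic; the edge stabilisers have order 2, which
    is invertible modulo l, so in positive degrees only the vertex stabilisers
    contribute to the homology of G, and these are the three dihedral groups.

    The proof makes this argument algebraic.  Homology is computed from the
    augmented complex M of ordered chains on G: the free module on finite sequences
    of elements of G.  For a set S of elements, [aug S] is the submodule of M
    spanned by the s x - x with s in S, so that M / [aug S] is the module of
    coinvariants of the subgroup generated by S.  Three facts replace the geometry.

    - Exactness in the middle, [coxeter_triangle_exact].  It holds for all p, q, r
      and all coefficients, and expresses that the complex is simply connected.
      Paths of triangles are words in a, b, c; by the defining relations, the edge
      path that follows a word depends, up to boundaries of triangles, only on the
      value of the word in G.  This gives a contracting homotopy.

    - Injectivity at the triangles, [triangle_aug_inj].  A chain killed in all
      three edge modules is negated by a, b and c.  Its support is finite and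
      stable under G, so the chain vanishes as soon as G is infinite.  If G were
      finite, exactness in the middle and a count of ranks over the rationals
      would give the complex the Euler characteristic 2 of a sphere, that is
      1/p + 1/q + 1/r = 1 + 4 / |G| ([finite_triangle_excess]).  The count needs
      that D1, D2, D3 have their full orders 2p, 2q, 2r; this is read off the
      geometric representation ([triangle_orders]).

    - Acyclicity of the edge modules in characteristic different from 2, by
      averaging over the reflection ([aug_acyclic]).

    A diagram chase then shows that every cycle modulo [aug G] is a sum of
    cycles modulo the [aug D_i], and that such a sum bounds only if each summand
    does ([cycle_split], [boundary_split]).  It remains to identify cycles
    modulo [aug D] in M with cycles of the bar complex of D: an equivariant
    retraction of G onto D gives a chain map, and the prism operator shows that it
    inverts the inclusion up to homotopy ([inhomog_retract]). *)

Set Implicit Arguments.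
Unset Strict Implicit.
Unset Printing Implicit Defensive.

Import Order.TTheory GRing.Theory Num.Theory.
Local Open Scope ring_scope.

(** * Free modules *)

Section FreeModules.
Variable R : fieldType.

Definition fsing (K : choiceType) (x : K) : {freeg K / R} := Freeg [:: (1, x)].

Lemma fsing_scale (K : choiceType) a (x : K) : Freeg [:: (a, x)] = a *: fsing x.
Proof. by apply/eqP/freeg_eqP => y; rewrite coeffZ !coeffU mul1r. Qed.

Lemma freeg_span (K : choiceType) (P : {freeg K / R} -> Prop) :
  P 0 -> (forall a x m, P m -> P (a *: fsing x + m)) -> forall m, P m.
Proof.
move=> P0 PD m; rewrite -[m]freeg_sumE.
elim: (freeg.dom m) => [|x s IH]; first by rewrite big_nil.
by rewrite big_cons fsing_scale; exact: PD.
Qed.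

Section Lift.
Variables (K : choiceType) (V : lmodType R) (f : K -> V).

Lemma fglift_sing x : fglift f (fsing x) = f x.
Proof. by rewrite /fsing liftU scale1r. Qed.

Lemma fglift_linear : linear (fglift f).
Proof.
have fB : {morph fglift f : u v / u - v} by exact: lift_is_additive.
have f0 : fglift f 0 = 0 by rewrite -[0 in LHS](subrr 0) fB subrr.
have fN u : fglift f (- u) = - fglift f u.
  by rewrite -[- u]add0r fB f0 add0r.
have fD u v : fglift f (u + v) = fglift f u + fglift f v.
  by rewrite -[v in LHS]opprK fB fN opprK.
move=> a u v; rewrite fD; congr (_ + _).
elim/freeg_span: u => [|b x u IH]; first by rewrite scaler0 f0 scaler0.
rewrite scalerDr !fD IH scalerDr scalerA -!fsing_scale !liftU scalerA.
by [].
Qed.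

HB.instance Definition _ :=
  GRing.isLinear.Build R {freeg K / R} V _ (fglift f) fglift_linear.
End Lift.

Lemma linear_eq (K : choiceType) (V : lmodType R)
    (f g : {linear {freeg K / R} -> V}) :
  (forall x, f (fsing x) = g (fsing x)) -> forall m, f m = g m.
Proof.
move=> fg; apply: freeg_span => [|a x m IH]; first by rewrite !linear0.
by rewrite !linearP fg IH.
Qed.

End FreeModules.
Arguments fsing {R K} x.

(** Identities between linear combinations are checked coefficient by coefficient. *)
Ltac freeg_ring :=
  apply/eqP/freeg_eqP => ?; rewrite !(coeffD, coeffN, coeffZ); ring.

(** * Ordered chains on a set *)

Section OrderedChains.
Variable R : fieldType.
Implicit Types X Y : choiceType.

Notation chain X := {freeg (seq X) / R}.

Definition cone X (x : X) : chain X -> chain X :=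
  fglift (fun s => fsing (x :: s)).
HB.instance Definition _ X (x : X) := GRing.Linear.on (cone x).

(** The alternating sum of the faces of a sequence, in recursive form: a face
    of x :: s drops x, or is x followed by a face of s.  The sequence of size one
    has the empty sequence as its boundary, so the complex is augmented. *)
Fixpoint bdry_seq X (s : seq X) : chain X :=
  if s is x :: s' then fsing s' - cone x (bdry_seq s') else 0.

Definition bdry X : chain X -> chain X := fglift (@bdry_seq X).
HB.instance Definition _ X := GRing.Linear.on (@bdry X).
Arguments bdry {X}.

Definition smap X Y (h : X -> Y) : chain X -> chain Y :=
  fglift (fun s => fsing (map h s)).
HB.instance Definition _ X Y (h : X -> Y) := GRing.Linear.on (smap h).

Lemma cone_sing X (x : X) s : cone x (fsing s) = fsing (x :: s).
Proof. exact: fglift_sing. Qed.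

Lemma bdry_sing X (s : seq X) : bdry (fsing s) = bdry_seq s.
Proof. exact: fglift_sing. Qed.

Lemma smap_sing X Y (h : X -> Y) s : smap h (fsing s) = fsing (map h s).
Proof. exact: fglift_sing. Qed.

(** Every cone is a contraction: the augmented complex is acyclic. *)
Lemma bdry_cone X (x : X) m : bdry (cone x m) = m - cone x (bdry m).
Proof.
move: m; apply: (linear_eq (f := bdry \o cone x)
  (g := idfun \- (cone x \o bdry))) => s /=.
by rewrite cone_sing !bdry_sing.
Qed.

Lemma bdryK X (m : chain X) : bdry (bdry m) = 0.
Proof.
move: m; apply: (linear_eq (f := bdry \o bdry) (g := \0)) => s /=.
rewrite bdry_sing; elim: s => [|x s IHs] /=; first by rewrite linear0.
by rewrite linearB /= bdry_cone IHs bdry_sing linear0 subr0 subrr.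
Qed.

Lemma smap_cone X Y (h : X -> Y) x m :
  smap h (cone x m) = cone (h x) (smap h m).
Proof.
move: m; apply: (linear_eq (f := smap h \o cone x)
  (g := cone (h x) \o smap h)) => s /=.
by rewrite cone_sing !smap_sing cone_sing.
Qed.

Lemma bdry_smap X Y (h : X -> Y) m : bdry (smap h m) = smap h (bdry m).
Proof.
move: m; apply: (linear_eq (f := bdry \o smap h)
  (g := smap h \o bdry)) => s /=.
rewrite smap_sing !bdry_sing.
elim: s => [|x s IHs] /=; first by rewrite linear0.
by rewrite linearB /= smap_cone IHs smap_sing.
Qed.

Lemma smap_comp X Y (Z : choiceType) (h : X -> Y) (k : Y -> Z) m :
  smap k (smap h m) = smap (k \o h) m.
Proof.
move: m; apply: (linear_eq (f := smap k \o smap h)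
  (g := smap (k \o h))) => s /=.
by rewrite !smap_sing map_comp.
Qed.

Lemma smap_id X (h : X -> X) m : h =1 id -> smap h m = m.
Proof.
move=> hid; move: m; apply: (linear_eq (f := smap h) (g := idfun)) => s /=.
by rewrite smap_sing (eq_map hid) map_id.
Qed.

Lemma bdry_seqE X (s : seq X) :
  bdry_seq s =
  \sum_(i < size s) (-1) ^+ i *: fsing (take i s ++ drop i.+1 s).
Proof.
elim: s => [|x s IH] /=; first by rewrite big_ord0.
rewrite big_ord_recl /= expr0 scale1r drop0 IH; congr (_ + _).
rewrite linear_sum /= -sumrN; apply: eq_bigr => i _.
by rewrite linearZ /= cone_sing exprS mulN1r scaleNr.
Qed.

(** The homotopy between f and the identity whose value on x0 :: .. :: xn is
    the alternating sum of the sequences f x0, .., f xi, xi, .., xn.  In recursive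
    form each property is one induction on sequences. *)
Fixpoint prism_seq X (f : X -> X) (s : seq X) : chain X :=
  if s is x :: s' then cone (f x) (fsing s - prism_seq f s') else 0.

Definition prism X (f : X -> X) : chain X -> chain X := fglift (prism_seq f).
HB.instance Definition _ X (f : X -> X) := GRing.Linear.on (prism f).

Lemma prism_sing X (f : X -> X) s : prism f (fsing s) = prism_seq f s.
Proof. exact: fglift_sing. Qed.

Lemma prism_cone X (f : X -> X) x m :
  prism f (cone x m) = cone (f x) (cone x m - prism f m).
Proof.
move: m; apply: (linear_eq (f := prism f \o cone x)
  (g := cone (f x) \o (cone x \- prism f))) => s /=.
by rewrite cone_sing !prism_sing.
Qed.

Lemma prism_homotopy X (f : X -> X) m :
  bdry (prism f m) + prism f (bdry m) = m - smap f m.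
Proof.
move: m; apply: (linear_eq (f := (bdry \o prism f) \+ (prism f \o bdry))
  (g := idfun \- smap f)) => s /=.
rewrite prism_sing bdry_sing smap_sing.
elim: s => [|x s IHs] /=; first by rewrite !linear0 subrr addr0.
rewrite bdry_cone !linearB /= prism_cone prism_sing bdry_sing /= !linearB /=.
have -> : bdry (prism_seq f s) = fsing s - fsing (map f s) - prism f (bdry_seq s).
  by rewrite -IHs addrK.
rewrite !linearB /= !cone_sing.
by freeg_ring.
Qed.
End OrderedChains.
Arguments bdry {R X}.

(** * Coinvariants of a group acting on chains *)

Section Coinvariants.
Variables (R : fieldType) (G : groupType).
Notation chain := {freeg (seq G) / R}.
Implicit Types (S T : G -> Prop) (g : G) (m : chain).

Definition lmuls g (s : seq G) : seq G := map (fun x => (g * x)%g) s.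

Inductive coinv_rel S : chain -> Prop :=
| CoinvRel0 : coinv_rel S 0
| CoinvRelD a g s m : S g -> coinv_rel S m ->
    coinv_rel S (a *: (fsing (lmuls g s) - fsing s) + m).

(** The kernel of the passage from chains to their coinvariants under the group
    generated by S.  For S the whole group it is the product of the
    augmentation ideal with the module of chains. *)
Definition aug S : {pred chain} := [pred m | `[< coinv_rel S m >]].

Lemma augP S m : reflect (coinv_rel S m) (m \in aug S).
Proof. exact: asboolP. Qed.

Lemma aug_closed S : submod_closed (aug S).
Proof.
split=> [|a u v /augP Su /augP Sv]; apply/augP; first exact: CoinvRel0.
elim: Su => [|b g s m Sg _ IH]; first by rewrite scaler0 add0r.
by rewrite scalerDr scalerA -addrA; exact: CoinvRelD.
Qed.

HB.instance Definition _ S :=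
  GRing.isSubmodClosed.Build R chain (aug S) (aug_closed S).

Lemma aug_sing S g s : S g -> fsing (lmuls g s) - fsing s \in aug S.
Proof.
move=> Sg; apply/augP; rewrite -[_ - _]scale1r -[_ *: _]addr0.
by apply: CoinvRelD => //; exact: CoinvRel0.
Qed.

Lemma aug_linear (V : lmodType R) (W : submodClosed V)
    (f : {linear chain -> V}) S m :
  (forall g s, S g -> f (fsing (lmuls g s)) - f (fsing s) \in W) ->
  m \in aug S -> f m \in W.
Proof.
move=> fW /augP; elim=> [|a g s m' Sg _ IH]; first by rewrite linear0 rpred0.
by rewrite linearP /= linearB rpredD // rpredZ // fW.
Qed.

Lemma aug_eq0 (V : lmodType R) (f : {linear chain -> V}) S m :
  (forall g s, S g -> f (fsing (lmuls g s)) = f (fsing s)) ->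
  m \in aug S -> f m = 0.
Proof.
move=> fS /augP; elim=> [|a g s m' Sg _ IH]; first by rewrite linear0.
by rewrite linearP /= linearB /= IH fS // subrr scaler0 addr0.
Qed.

(** Only the group generated by the set matters. *)
Lemma aug_gen S T m :
  (forall g s, S g -> fsing (lmuls g s) - fsing s \in aug T) ->
  m \in aug S -> m \in aug T.
Proof. exact: (@aug_linear _ (aug T) idfun). Qed.

Lemma aug_sub S T m : (forall g, S g -> T g) -> m \in aug S -> m \in aug T.
Proof. by move=> ST; apply: aug_gen => g s /ST; exact: aug_sing. Qed.

Lemma aug_split S T m : m \in aug (fun g => S g \/ T g) ->
  exists u v, [/\ u \in aug S, v \in aug T & m = u + v].
Proof.
move/augP; elim=> [|a g s m' STg _ [u [v [Su Tv ->]]]].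
  by exists 0, 0; rewrite !rpred0 addr0.
case: STg => [Sg|Tg].
  exists (a *: (fsing (lmuls g s) - fsing s) + u), v.
  by rewrite addrA rpredD // rpredZ // aug_sing.
exists u, (a *: (fsing (lmuls g s) - fsing s) + v).
by rewrite addrCA (rpredD _ Tv) // rpredZ // aug_sing.
Qed.

Lemma lmuls1 s : lmuls 1 s = s.
Proof. by rewrite /lmuls (eq_map (@mul1g G)) map_id. Qed.

Lemma lmulsM g h s : lmuls (g * h) s = lmuls g (lmuls h s).
Proof. by rewrite /lmuls -map_comp; apply: eq_map => x /=; rewrite mulgA. Qed.

Definition trans g : chain -> chain := smap (fun x => (g * x)%g).
HB.instance Definition _ g := GRing.Linear.on (trans g).

Lemma trans_sing g s : trans g (fsing s) = fsing (lmuls g s).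
Proof. exact: smap_sing. Qed.

Lemma bdry_trans g m : bdry (trans g m) = trans g (bdry m).
Proof. exact: bdry_smap. Qed.

Lemma transM g h m : trans g (trans h m) = trans (g * h) m.
Proof.
move: m; apply: (linear_eq (f := trans g \o trans h)
  (g := trans (g * h))) => s /=.
by rewrite !trans_sing lmulsM.
Qed.

Lemma trans1 m : trans 1 m = m.
Proof. by apply: smap_id => x; rewrite mul1g. Qed.

Lemma aug_trans S g m : S g -> trans g m - m \in aug S.
Proof.
move=> Sg; elim/freeg_span: m => [|a s m IH].
  by rewrite linear0 subrr rpred0.
rewrite linearP /= opprD addrACA rpredD //.
by rewrite trans_sing -scalerBr rpredZ // aug_sing.
Qed.

Lemma aug_bdry S m : m \in aug S -> bdry m \in aug S.
Proof.
apply: aug_linear => g s Sg /=.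
by rewrite -trans_sing bdry_trans aug_trans.
Qed.

Section Involution.
Variables (g : G) (gg : (g * g = 1)%g).

(** Since g (g x - x) = - (g x - x) for an involution g. *)
Lemma aug_anti m : m \in aug (eq g) -> trans g m = - m.
Proof.
move=> gm; apply/eqP; rewrite -subr_eq0 opprK; apply/eqP.
apply: (@aug_eq0 _ (trans g \+ idfun) (eq g)) gm => _ s <- /=.
by rewrite !trans_sing -lmulsM gg lmuls1 addrC.
Qed.

Hypothesis two_neq0 : 2%:R != 0 :> R.

(** If g m = - m, then m is - 1/2 times g m - m. *)
Lemma anti_aug m : trans g m = - m -> m \in aug (eq g).
Proof.
move=> gm; have -> : m = (- 2%:R^-1) *: (trans g m - m).
  rewrite gm -opprD scalerN scaleNr opprK -mulr2n -scaler_nat scalerA.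
  by rewrite mulVf // scale1r.
by rewrite rpredZ // aug_trans.
Qed.

(** The group of order 2 has no homology when 2 is invertible: if the boundary
    of m vanishes in the coinvariants, then m + g m is a cycle, hence the boundary of
    a cone, and m differs from half of it by an anti-invariant chain. *)
Lemma aug_acyclic m : bdry m \in aug (eq g) ->
  exists y, m - bdry y \in aug (eq g).
Proof.
move=> /aug_anti gm; exists (2%:R^-1 *: cone 1%g (m + trans g m)).
rewrite linearZ /= bdry_cone [bdry (m + _)]linearD /= bdry_trans gm subrr linear0 subr0.
apply: anti_aug; rewrite linearB linearZ /= linearD /= transM gg trans1.
by apply/eqP/freeg_eqP => z; rewrite !(coeffD, coeffN, coeffZ); field.
Qed.
End Involution.

End Coinvariants.

(** * Homogeneous and inhomogeneous bar chains *)

Section BarComparison.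
Variables (R : fieldType) (G : groupType).
Notation chain := {freeg (seq G) / R}.
Notation bar n := (bar_chain R G n).

(** The bar symbol [g1 | .. | gn] is the orbit of (1, g1, g1 g2, ..). *)
Definition homog n : bar n -> chain :=
  fglift (fun t : n.-tuple G => fsing (1%g :: scanl mulg 1%g t)).
HB.instance Definition _ n := GRing.Linear.on (@homog n).

Definition ratios (s : seq G) : seq G :=
  if s is x :: s' then pairmap (fun a b => (a^-1 * b)%g) x s' else [::].

(** The empty sequence, which lives in the augmentation degree, is sent to 0
    explicitly: it has the same empty list of ratios as a sequence of size one. *)
Definition inhomog_seq n (s : seq G) : bar n :=
  if s is [::] then 0 else oapp (@bar_symbol R G n) 0 (insub (ratios s)).

Definition inhomog n : chain -> bar n := fglift (@inhomog_seq n).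
HB.instance Definition _ n := GRing.Linear.on (@inhomog n).

Lemma size_ratios s : size (ratios s) = (size s).-1.
Proof. by case: s => //= x s; rewrite size_pairmap. Qed.

Lemma nth_ratios s k : (k.+1 < size s)%N ->
  nth 1%g (ratios s) k = ((nth 1 s k)^-1 * nth 1 s k.+1)%g.
Proof. by case: s => //= x s lt_ks; rewrite (nth_pairmap 1%g). Qed.

Lemma ratios_lmuls g s : ratios (lmuls g s) = ratios s.
Proof.
apply: (@eq_from_nth _ 1%g); rewrite ?size_ratios size_map // => k.
move=> lt_k; have lt_k1 : (k.+1 < size s)%N by case: (s) lt_k.
rewrite !nth_ratios ?size_map // !(nth_map 1%g) //; last exact: ltnW.
by rewrite invgM -mulgA mulKg.
Qed.

Lemma inhomog_tuple n s (t : n.-tuple G) : size s = n.+1 -> ratios s = t ->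
  inhomog n (fsing s) = bar_symbol R t.
Proof.
rewrite /inhomog fglift_sing; case: s => // x s _ st.
by rewrite /inhomog_seq st valK.
Qed.

Lemma inhomog_size n s : size s != n.+1 -> inhomog n (fsing s) = 0.
Proof.
rewrite /inhomog fglift_sing; case: s => // x s; rewrite /inhomog_seq eqSS => ns.
by rewrite insubN // size_ratios.
Qed.

Lemma inhomog_aug n S m : m \in aug S -> inhomog n m = 0.
Proof.
apply: aug_eq0 => g s _ /=; rewrite /inhomog !fglift_sing.
by rewrite /inhomog_seq ratios_lmuls; case: s.
Qed.

Lemma homogK n (c : bar n) : inhomog n (homog c) = c.
Proof.
move: c; apply: (linear_eq (f := @inhomog n \o @homog n) (g := idfun)) => t /=.
rewrite /homog fglift_sing; apply: inhomog_tuple.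
  by rewrite /= size_scanl size_tuple.
by rewrite /ratios scanlK // => x y; rewrite mulKg.
Qed.

(** A sequence x0, .., xn and its normalisation 1, x0^-1 x1, .. lie in the same orbit. *)
Lemma inhomogK_sing n s : size s = n.+1 ->
  homog (inhomog n (fsing s)) - fsing s \in aug (fun=> True).
Proof.
case: s => // x s [sz]; have tP : size (ratios (x :: s)) == n.
  by rewrite size_ratios /= sz.
rewrite (@inhomog_tuple n _ (Tuple tP)) //= ?sz // /homog fglift_sing /=.
have -> : 1%g :: scanl mulg 1%g (pairmap (fun a b => (a^-1 * b)%g) x s)
    = lmuls x^-1 (x :: s).
  rewrite /= mulVg; congr (_ :: _);
  apply: (canLR (pairmapK (f := fun a b => (a^-1 * b)%g) _ 1%g)).
    by move=> y z /=; rewrite mulVKg.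
  have := ratios_lmuls x^-1 (x :: s).
  by rewrite /= mulVg => ->.
exact: aug_sing.
Qed.

(** Deleting the i-th entry of a sequence multiplies two neighbouring ratios,
    or drops an extreme one: this is the i-th face of the bar complex. *)
Lemma inhomog_bdry n m : inhomog n (bdry m) = bar_diff (inhomog n.+1 m).
Proof.
move: m; apply: (linear_eq (f := @inhomog n \o bdry)
  (g := @bar_diff R G n \o @inhomog n.+1)) => s /=.
rewrite bdry_sing bdry_seqE linear_sum /=.
have sz i : (i < size s)%N -> size (take i s ++ drop i.+1 s) = (size s).-1.
  by move=> lt_i; rewrite size_cat size_take size_drop lt_i; lia.
case: (eqVneq (size s) n.+2) => [szs|nszs]; last first.
  rewrite [inhomog n.+1 _]inhomog_size // linear0 big1 // => i _.
  rewrite linearZ /= inhomog_size ?scaler0 // sz //.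
  by case: (size s) nszs.
have tP : size (ratios s) == n.+1 by rewrite size_ratios szs.
rewrite (@inhomog_tuple n.+1 _ (Tuple tP)) // bar_diffE.
have lt_sz (i : 'I_n.+2) : (i < size s)%N by rewrite szs.
rewrite szs.
apply: eq_bigr => i _; rewrite linearZ /=; congr (_ *: _).
apply: inhomog_tuple; first by rewrite sz ?szs.
have del_nth k : nth 1%g (take i s ++ drop i.+1 s) k =
    nth 1%g s (if (k < i)%N then k else k.+1).
  rewrite nth_cat size_take lt_sz; case: ltnP => [lt_ki|le_ik].
    by rewrite nth_take.
  by rewrite nth_drop addSn subnKC.
apply: (@eq_from_nth _ 1%g); first by rewrite size_ratios sz // szs size_tuple.
rewrite size_ratios sz // szs /= => k lt_kn.
rewrite -(tnth_nth _ (bar_face i (Tuple tP)) (Ordinal lt_kn)) bar_faceE /=.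
rewrite nth_ratios ?sz ?szs // !del_nth.
have lt1 : (k.+1 < size s)%N by rewrite szs !ltnS ltnW.
have lt2 : (k.+2 < size s)%N by rewrite szs !ltnS.
by rewrite !nth_ratios //; case: (ltngtP k.+1 i) => // _; rewrite -mulgA mulVKg.
Qed.

(** The face that drops the leading 1 does not start with 1, so this map is
    a chain map only modulo the action of the group. *)
Lemma homog_bdry n (c : bar n.+1) :
  bdry (homog c) - homog (bar_diff c) \in aug (fun=> True).
Proof.
elim/bar_chain_ind: c => [|a t c IH].
  by rewrite !linear0 addr0 rpred0.
rewrite !linearP /= addrACA -scalerDr rpredD ?rpredZ //.
have [xs xsE] : {xs | xs = 1%g :: scanl mulg 1%g t} by exists (1%g :: scanl mulg 1%g t).
have hxs : homog (bar_symbol R t) = fsing xs by rewrite /homog fglift_sing xsE.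
have sz_xs : size xs = n.+2 by rewrite xsE /= size_scanl size_tuple.
rewrite -[bar_symbol R t in X in _ - X]homogK -inhomog_bdry hxs.
rewrite bdry_sing bdry_seqE sz_xs linear_sum /= linear_sum /= -sumrB.
apply: rpred_sum => i _; rewrite linearZ /= linearZ /=.
rewrite -scalerBr rpredZ //.
rewrite -rpredN opprB; apply: inhomogK_sing.
have lt_i := ltn_ord i.
by rewrite size_cat size_take size_drop sz_xs; case: ltnP; lia.
Qed.
End BarComparison.

(** * Passage to a subgroup *)

Section Subgroups.
Variables (R : fieldType) (H G : groupType) (phi : H -> G).
Hypothesis phiM : {morph phi : x y / (x * y)%g}.
Hypothesis phi_inj : injective phi.

Lemma mul_morph1 : phi 1%g = 1%g.
Proof. by apply: (@mulgI _ (phi 1%g)); rewrite -phiM !mulg1. Qed.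

Lemma mul_morphV x : phi x^-1%g = (phi x)^-1%g.
Proof. by apply: (@mulgI _ (phi x)); rewrite -phiM !mulgV mul_morph1. Qed.

(** Choose a representative in each right coset of the image of H; the element
    phi h * rep is sent to h, up to a right translation that makes the retraction the
    identity on H.  Canonical choice makes the representative depend on the coset only. *)
Lemma equivariant_retraction :
  exists rho : G -> H, (forall h g, rho (phi h * g)%g = (h * rho g)%g) /\
    (forall h, rho (phi h) = h).
Proof.
pose coset g : pred G := [pred x | `[< exists h, x = (phi h * g)%g >]].
have cosetg g : coset g g.
  by apply/asboolP; exists 1%g; rewrite mul_morph1 mul1g.
have cosetM h g : coset (phi h * g)%g =1 coset g.
  move=> x; apply/asboolP/asboolP => -[k ->].
    by exists (k * h)%g; rewrite phiM mulgA.
  by exists (k * h^-1)%g; rewrite mulgA -phiM mulgVK.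
pose rep g := choose (coset g) g.
have repP g : exists h, g == (phi h * rep g)%g.
  have /asboolP[h hE] : coset g (rep g) by exact: chooseP.
  by exists h^-1%g; rewrite hE mulgA -phiM mulVg mul_morph1 mul1g.
have repM h g : rep (phi h * g)%g = rep g.
  rewrite /rep (eq_choose (cosetM h g)).
  by apply: choose_id => //; rewrite -(cosetM h g).
pose rho g := xchoose (repP g).
have rhoE g : g = (phi (rho g) * rep g)%g by apply/eqP/(xchooseP (repP g)).
have rhoM h g : rho (phi h * g)%g = (h * rho g)%g.
  apply: phi_inj; apply: (@mulIg _ (rep g)).
  by rewrite -{1}(repM h g) -rhoE phiM -mulgA -rhoE.
(* Right translation keeps equivariance and normalises the value on the image of H. *)
exists (fun g => (rho g * (rho 1%g)^-1)%g); split=> [h g|h].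
  by rewrite rhoM mulgA.
by rewrite -{1}[phi h]mulg1 rhoM mulgK.
Qed.

Notation bar := (bar_chain R).

(** The map induced on bar complexes by a group morphism, defined through ordered
    chains so that no computation on tuples is needed. *)
Definition bar_map n (c : bar H n) : bar G n :=
  inhomog n (smap phi (homog c)).

Lemma bar_map_linear n : linear (@bar_map n).
Proof. by move=> a u v; rewrite /bar_map !linearP. Qed.
HB.instance Definition _ n :=
  GRing.isLinear.Build R (bar H n) (bar G n) _ (@bar_map n) (@bar_map_linear n).

Lemma map_phi_lmuls h s : map phi (lmuls h s) = lmuls (phi h) (map phi s).
Proof. by rewrite /lmuls -!map_comp; apply: eq_map => x /=; rewrite phiM. Qed.

Lemma smap_phi_aug m : m \in aug (R := R) (fun=> True) ->
  smap phi m \in aug (fun=> True).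
Proof.
apply: aug_linear => h s _ /=; rewrite !smap_sing map_phi_lmuls.
exact: aug_sing.
Qed.

Lemma bar_map_inhomog n m :
  bar_map (inhomog n m) = inhomog n (smap phi m).
Proof.
move: m; apply: (linear_eq (f := @bar_map n \o inhomog n)
  (g := inhomog n \o smap phi)) => s /=.
case: (eqVneq (size s) n.+1) => [sz|nsz]; last first.
  by rewrite smap_sing !inhomog_size ?linear0 // size_map.
apply/eqP; rewrite -subr_eq0 /bar_map -!linearB /=; apply/eqP.
apply: inhomog_aug (smap_phi_aug _); exact: inhomogK_sing.
Qed.

Lemma bar_map_diff n (c : bar H n.+1) :
  bar_diff (bar_map c) = bar_map (bar_diff c).
Proof.
rewrite {1}/bar_map -inhomog_bdry bdry_smap -bar_map_inhomog inhomog_bdry.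
by rewrite homogK.
Qed.

Lemma homog_bar_map n (c : bar H n) :
  homog (bar_map c) - smap phi (homog c) \in aug (fun=> True).
Proof.
elim/bar_chain_ind: c => [|a t c IH]; first by rewrite !linear0 addr0 rpred0.
rewrite !linearP /= addrACA -scalerDr rpredD ?rpredZ //.
rewrite /bar_map /homog [X in smap phi X]fglift_sing smap_sing.
by apply: inhomogK_sing; rewrite /= size_map size_scanl size_tuple.
Qed.

Variables (S : G -> Prop) (rho : G -> H).
Hypothesis S_phi : forall g, S g -> exists h, g = phi h.
Hypothesis S_gen :
  forall h s, fsing (lmuls (phi h) s) - fsing s \in aug (R := R) S.
Hypothesis rhoM : forall h g, rho (phi h * g)%g = (h * rho g)%g.
Hypothesis rhoK : forall h, rho (phi h) = h.

Lemma smap_homog_cycle n (c : bar H n.+1) : bar_diff c = 0 ->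
  bdry (smap phi (homog c)) \in aug S.
Proof.
move=> c0; rewrite bdry_smap; have := homog_bdry c; rewrite c0 linear0 subr0.
apply: aug_linear => h s _ /=; rewrite !smap_sing map_phi_lmuls.
exact: S_gen.
Qed.

Lemma retract_homog n (c : bar H n) :
  inhomog n (smap rho (smap phi (homog c))) = c.
Proof. by rewrite smap_comp smap_id ?homogK // => h /=; rewrite rhoK. Qed.

Lemma map_rho_lmuls h s : map rho (lmuls (phi h) s) = lmuls h (map rho s).
Proof. by rewrite /lmuls -!map_comp; apply: eq_map => x /=; rewrite rhoM. Qed.

Lemma retract_aug n m : m \in aug S -> inhomog (R := R) n (smap rho m) = 0.
Proof.
move=> Sm; apply: (@inhomog_aug _ _ _ (fun=> True)); move: Sm.
apply: aug_linear => g s /S_phi[h ->] /=; rewrite !smap_sing map_rho_lmuls.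
exact: aug_sing.
Qed.

(** The prism operator commutes with the action of H, because phi \o rho does. *)
Lemma prism_rho_aug m : m \in aug (R := R) S ->
  prism (phi \o rho) m \in aug S.
Proof.
apply: aug_linear => g s Sg /=.
suff -> : prism (phi \o rho) (fsing (lmuls g s)) =
    trans g (prism (phi \o rho) (fsing s)) :> {freeg (seq G) / R}.
  exact: aug_trans.
have [h gE] := S_phi Sg; rewrite !prism_sing gE /trans.
elim: s => [|x s IH] /=; first by rewrite linear0.
by rewrite IH smap_cone [smap _ (_ - _)]linearB /= smap_sing /= rhoM phiM.
Qed.

(** On a cycle modulo the action of H, the prism operator provides a homotopy
    between the identity and the retraction onto H. *)
Lemma inhomog_retract n z : bdry z \in aug (R := R) S ->
  exists y, inhomog n z - bar_map (inhomog n (smap rho z)) = bar_diff y.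
Proof.
move=> Sz; exists (inhomog n.+1 (prism (phi \o rho) z)).
rewrite bar_map_inhomog smap_comp -linearB /= -prism_homotopy linearD /=.
by rewrite (inhomog_aug n (prism_rho_aug Sz)) addr0 inhomog_bdry.
Qed.

End Subgroups.

(** * Diagram chase for three involutions *)

Section TriangleOfGroups.
Variables (R : fieldType) (G : groupType) (a b c : G).
Hypothesis two_neq0 : 2%:R != 0 :> R.
Hypotheses (aa : (a * a = 1)%g) (bb : (b * b = 1)%g) (cc : (c * c = 1)%g).

Notation chain := {freeg (seq G) / R}.
Notation aug1 x := (aug (R := R) (eq x)).
Notation aug2 x y := (aug (R := R) (fun g => x = g \/ y = g)).
Notation augT := (aug (R := R) (fun _ : G => True)).

Hypothesis triangle_exact : forall ea eb ec : chain,
  eb - ea \in aug2 a b -> ec - eb \in aug2 b c -> ea - ec \in aug2 c a ->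
  exists m : chain, [/\ ea - m \in aug1 a, eb - m \in aug1 b & ec - m \in aug1 c].
Hypothesis triangle_inj : forall m : chain,
  m \in aug1 a -> m \in aug1 b -> m \in aug1 c -> m = 0.
Hypothesis abc_gen : forall g (s : seq G),
  fsing (lmuls g s) - fsing s \in aug (R := R) (fun g => (a = g \/ b = g) \/ c = g).

Lemma aug2l (x y : G) m : m \in aug1 x -> m \in aug2 x y.
Proof. by apply: aug_sub => g; left. Qed.

Lemma aug2r (x y : G) m : m \in aug1 y -> m \in aug2 x y.
Proof. by apply: aug_sub => g; right. Qed.

(** A product of generators moves a chain by a sum of moves by single generators. *)
Lemma aug_all m : m \in augT ->
  exists u v w, [/\ u \in aug2 a b, v \in aug2 b c, w \in aug2 c a &
                    m = u + v + w].
Proof.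
move=> Gm; have : m \in aug (R := R) (fun g => (a = g \/ b = g) \/ c = g).
  by apply: aug_gen Gm => g s _; exact: abc_gen.
case/aug_split => [u [v [ab_u c_v ->]]].
by exists u, v, 0; rewrite addr0 rpred0 (aug2r b c_v).
Qed.

(** The common core of the two halves of the comparison.  The boundaries of the
    three edge chains come from one chain m by exactness; m is a cycle by
    injectivity, hence the boundary of some y; and e - y is now a cycle in
    each edge module, which is acyclic. *)
Lemma edge_chase (ea eb ec : chain) :
  bdry (eb - ea) \in aug2 a b -> bdry (ec - eb) \in aug2 b c ->
  bdry (ea - ec) \in aug2 c a ->
  exists y fa fb fc, [/\ ea - y - bdry fa \in aug1 a,
    eb - y - bdry fb \in aug1 b & ec - y - bdry fc \in aug1 c].
Proof.
rewrite !linearB /= => ab bc ca.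
have [m [am bm cm]] := triangle_exact ab bc ca.
have bdry_m (x : G) e : bdry e - m \in aug1 x -> bdry m \in aug1 x.
  by move=> /aug_bdry; rewrite linearB /= bdryK sub0r rpredN.
have m0 : bdry m = 0 by apply: triangle_inj; apply: bdry_m; eauto.
pose y := cone 1%g m.
have yE : bdry y = m by rewrite bdry_cone m0 linear0 subr0.
have {am} [fa Ha] : exists f, ea - y - bdry f \in aug1 a.
  by apply: aug_acyclic => //; rewrite linearB /= yE.
have {bm} [fb Hb] : exists f, eb - y - bdry f \in aug1 b.
  by apply: aug_acyclic => //; rewrite linearB /= yE.
have {cm} [fc Hc] : exists f, ec - y - bdry f \in aug1 c.
  by apply: aug_acyclic => //; rewrite linearB /= yE.
by exists y, fa, fb, fc.
Qed.

(** Lift z to the vertex modules as (z, 0, 0).  The boundary of this lift comes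
    from edge chains, and correcting the lift by the chains f of [edge_chase]
    turns its three components into cycles. *)
Lemma cycle_split (z : chain) : bdry z \in augT ->
  exists u v w, [/\ bdry u \in aug2 a b, bdry v \in aug2 b c,
    bdry w \in aug2 c a & z = u + v + w].
Proof.
move=> /aug_all[u [v [w [ab_u bc_v ca_w zE]]]].
have [||| y [fa [fb [fc [Ha Hb Hc]]]]] := @edge_chase 0 (v + w) w.
- have -> : v + w - 0 = bdry z - u by rewrite zE; freeg_ring.
  by rewrite linearB /= bdryK sub0r rpredN aug_bdry.
- have -> : w - (v + w) = - v by freeg_ring.
  by rewrite linearN /= rpredN aug_bdry.
- by rewrite sub0r linearN /= rpredN aug_bdry.
exists (z - (fb - fa)), (fb - fc), (fc - fa); split; last by freeg_ring.
- have -> : bdry (z - (fb - fa)) = u + (v + w - y - bdry fb) - (0 - y - bdry fa).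
    by rewrite !linearB /= zE; freeg_ring.
  by apply: rpredB (aug2l _ Ha); apply: rpredD (aug2r _ Hb).
- have -> : bdry (fb - fc) = v - (v + w - y - bdry fb) + (w - y - bdry fc).
    by rewrite !linearB /=; freeg_ring.
  by apply: rpredD (aug2r _ Hc); apply: rpredB (aug2l _ Hb).
- have -> : bdry (fc - fa) = w - (w - y - bdry fc) + (0 - y - bdry fa).
    by rewrite !linearB /=; freeg_ring.
  by apply: rpredD (aug2r _ Ha); apply: rpredB (aug2l _ Hc).
Qed.

(** Moving y and its correction terms into u, v, w turns the relation into
    u + v + w = 0, so that u, v, w are differences of three edge chains; by
    [edge_chase] these are boundaries up to a common chain y and up to terms that
    vanish in the vertex modules. *)
Lemma boundary_split (u v w y : chain) :
  bdry u \in aug2 a b -> bdry v \in aug2 b c -> bdry w \in aug2 c a ->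
  u + v + w - bdry y \in augT ->
  exists u' v' w', [/\ u - bdry u' \in aug2 a b, v - bdry v' \in aug2 b c &
    w - bdry w' \in aug2 c a].
Proof.
move=> ab_u bc_v ca_w /aug_all[u0 [v0 [w0 [ab0 bc0 ca0 sumE]]]].
pose eb := u - bdry y - u0; pose ec := eb + (v - v0).
have ecE : 0 - ec = w - w0.
  have -> : w = bdry y + (u0 + v0 + w0) - u - v.
    by rewrite -sumE; freeg_ring.
  by rewrite /ec /eb; freeg_ring.
have [||| t [fa [fb [fc [Ha Hb Hc]]]]] := @edge_chase 0 eb ec.
- rewrite subr0 /eb !linearB /= bdryK subr0; apply: rpredB => //; exact: aug_bdry.
- have -> : ec - eb = v - v0 by rewrite /ec; freeg_ring.
  rewrite linearB /=; apply: rpredB => //; exact: aug_bdry.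
- rewrite ecE linearB /=; apply: rpredB => //; exact: aug_bdry.
exists (y + fb - fa), (fc - fb), (fa - fc); split.
- have -> : u - bdry (y + fb - fa) = u0 + (eb - t - bdry fb) - (0 - t - bdry fa).
    by rewrite !(linearB, linearD) /= /eb; freeg_ring.
  by apply: rpredB (aug2l _ Ha); apply: rpredD (aug2r _ Hb).
- have -> : v - bdry (fc - fb) = v0 - (eb - t - bdry fb) + (ec - t - bdry fc).
    by rewrite !linearB /= /ec; freeg_ring.
  by apply: rpredD (aug2r _ Hc); apply: rpredB (aug2l _ Hb).
- have -> : w - bdry (fa - fc) = w0 - (ec - t - bdry fc) + (0 - t - bdry fa).
    by rewrite -[w](subrK w0) -ecE !linearB /=; freeg_ring.
  by apply: rpredD (aug2r _ Ha); apply: rpredB (aug2l _ Hc).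
Qed.

End TriangleOfGroups.

(** * Exactness of the Coxeter complex *)

Section PresentedWords.
Variables (X : choiceType) (rels : seq (word X)).
Local Open Scope quotient_scope.
Notation grp := (presented rels).

Definition word_val (w : word X) : grp := \pi_grp w.
Definition gen (x : X) : grp := word_val [:: (x, false)].

Lemma word_val_cat u v : word_val (u ++ v) = (word_val u * word_val v)%g.
Proof.
apply/presented_eqP; apply: WSym.
by apply: WCat; exact: repr_presented.
Qed.

Lemma word_val_nil : word_val [::] = 1%g.
Proof. by []. Qed.

Lemma word_val_repr (g : grp) : word_val (repr g) = g.
Proof. exact: reprK. Qed.

Lemma word_val_rel w : w \in rels -> word_val w = 1%g.
Proof. by move=> /WRel rw; apply/presented_eqP. Qed.

Hypothesis gen2 : forall x, (gen x * gen x = 1)%g.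

Lemma word_val_letter x b : word_val [:: (x, b)] = gen x.
Proof.
case: b => //; apply: (@mulgI _ (gen x)); rewrite gen2 -word_val_cat /=.
by apply/presented_eqP; exact: (WCancel _ x false).
Qed.

Lemma word_val_cons x b w : word_val ((x, b) :: w) = (gen x * word_val w)%g.
Proof. by rewrite -cat1s word_val_cat word_val_letter. Qed.
End PresentedWords.

Section CoxeterComplex.
Variables (R : fieldType) (p q r : nat).

Notation rels := (triangle_rels p q r).
Notation grp := (triangle_group p q r).
Notation chain := {freeg (seq grp) / R}.
Notation aug1 x := (aug (R := R) (eq (x : grp))).
Notation aug2 x y := (aug (R := R) (fun g : grp => x = g \/ y = g)).

Notation ia := (inord 0 : 'I_3).
Notation ib := (inord 1 : 'I_3).
Notation ic := (inord 2 : 'I_3).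
Definition ga : grp := gen rels ia.
Definition gb : grp := gen rels ib.
Definition gc : grp := gen rels ic.

Lemma letter3 (i : 'I_3) : [\/ i = ia, i = ib | i = ic].
Proof.
case: i => -[|[|[|//]]] lt_i; [constructor 1|constructor 2|constructor 3];
  by apply/val_inj; rewrite /= inordK.
Qed.

Lemma letter_neq : [/\ ia == ib = false, ib == ic = false & ia == ic = false].
Proof. by split; apply/eqP => /(congr1 val); rewrite /= !inordK. Qed.

Lemma gen_invol i : (gen rels i * gen rels i = 1)%g.
Proof.
rewrite -word_val_cat; apply: word_val_rel.
by case: (letter3 i) => ->; rewrite !inE eqxx ?orbT.
Qed.

Lemma gaa : (ga * ga = 1)%g. Proof. exact: gen_invol. Qed.
Lemma gbb : (gb * gb = 1)%g. Proof. exact: gen_invol. Qed.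
Lemma gcc : (gc * gc = 1)%g. Proof. exact: gen_invol. Qed.

Definition edges := (chain * chain * chain)%type.

(** Families of edge chains that bound a chain of triangles.  The components
    belong to the edges fixed by a, b and c. *)
Definition filled : {pred edges} := [pred e | `[< exists m : chain,
  [/\ e.1.1 - m \in aug1 ga, e.1.2 - m \in aug1 gb & e.2 - m \in aug1 gc] >]].

Lemma filled_closed : submod_closed filled.
Proof.
split=> [|k u v /asboolP[m [ma mb mc]] /asboolP[m' [ma' mb' mc']]]; apply/asboolP.
  by exists 0; rewrite subr0 !rpred0.
exists (k *: m + m'); split; rewrite /= opprD addrACA -scalerBr;
  by rewrite rpredD ?rpredZ.
Qed.
HB.instance Definition _ :=
  GRing.isSubmodClosed.Build R edges filled filled_closed.

Lemma filledE (u v w : chain) m : u - m \in aug1 ga -> v - m \in aug1 gb ->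
  w - m \in aug1 gc -> (u, v, w) \in filled.
Proof. by move=> *; apply/asboolP; exists m. Qed.

Lemma filled0 (u v w : chain) : u \in aug1 ga -> v \in aug1 gb ->
  w \in aug1 gc -> (u, v, w) \in filled.
Proof. by move=> *; apply: (@filledE _ _ _ 0); rewrite subr0. Qed.

(** Crossing an edge fixed by a or b keeps the vertex of the subgroup generated
    by a and b; crossing the edge fixed by c from the triangle s moves that vertex
    along the b-edges of c s and of s. *)
Definition step (i : 'I_3) (s : seq grp) : edges :=
  if i == ic then (0, fsing (lmuls gc s) - fsing s, 0) else 0.

(** The edge path followed by the vertex of type (a, b) when the triangle s is
    moved by the letters of w, starting from the last one. *)
Fixpoint path (s : seq grp) (w : word 'I_3) : edges :=
  if w is l :: w' then path s w' + step l.1 (lmuls (word_val rels w') s) else 0.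

Lemma path_cat s u v :
  path s (u ++ v) = path s v + path (lmuls (word_val rels v) s) u.
Proof.
elim: u => [|l u IH] /=; first by rewrite addr0.
by rewrite IH word_val_cat lmulsM addrA.
Qed.

Lemma path_ab s w : all (fun l => l.1 != ic) w -> path s w = 0.
Proof.
elim: w => //= l w IH /andP[lc /IH ->].
by rewrite /step (negbTE lc) addr0.
Qed.

(** Around a vertex of type (b, c), the path is homotopic to going to that vertex
    along the b-edge and coming back along another b-edge. *)
Lemma path_bc s w : all (fun l => l.1 != ia) w ->
  path s w - (0, fsing (lmuls (word_val rels w) s) - fsing s, 0) \in filled.
Proof.
elim: w => [_|[i e] w IH /= /andP[/= ia' /IH {}IH]].
  by rewrite word_val_nil lmuls1 subrr subr0 rpred0.
rewrite word_val_cons; last exact: gen_invol.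
rewrite lmulsM; set t := lmuls (word_val rels w) s in IH *.
set P := path s w in IH *.
have -> : P + step i t - (0, fsing (lmuls (gen rels i) t) - fsing s, 0) =
  (P - (0, fsing t - fsing s, 0)) +
  (step i t - (0, fsing (lmuls (gen rels i) t) - fsing t, 0)).
  rewrite addrACA -opprD; congr (_ + _ - _).
  by congr (_, _, _); rewrite ?addr0 //; freeg_ring.
rewrite rpredD // /step; case: (letter3 i) => iE.
- by rewrite iE eqxx in ia'.
- have [_ nbc _] := letter_neq; rewrite iE nbc sub0r rpredN.
  by apply: filled0; rewrite ?rpred0 // aug_sing.
- by rewrite iE eqxx subrr rpred0.
Qed.

(** As in [path_bc], along a-edges.  Crossing the edge fixed by c is where the
    boundary of a triangle is used, to trade b-edges for a-edges. *)
Lemma path_ca s w : all (fun l => l.1 != ib) w ->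
  path s w - (fsing s - fsing (lmuls (word_val rels w) s), 0, 0) \in filled.
Proof.
elim: w => [_|[i e] w IH /= /andP[/= ib' /IH {}IH]].
  by rewrite word_val_nil lmuls1 subrr subr0 rpred0.
rewrite word_val_cons; last exact: gen_invol.
rewrite lmulsM; set t := lmuls (word_val rels w) s in IH *.
set P := path s w in IH *.
have -> : P + step i t - (fsing s - fsing (lmuls (gen rels i) t), 0, 0) =
  (P - (fsing s - fsing t, 0, 0)) +
  (step i t + (fsing (lmuls (gen rels i) t) - fsing t, 0, 0)).
  rewrite [RHS]addrACA; congr (_ + _).
  by congr (_, _, _); rewrite /= ?(oppr0, addr0) //; freeg_ring.
rewrite rpredD // /step; case: (letter3 i) => iE.
- have [_ _ nac] := letter_neq; rewrite iE nac add0r.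
  by apply: filled0; rewrite ?rpred0 // aug_sing.
- by rewrite iE eqxx in ib'.
- rewrite iE eqxx; apply: (@filledE _ _ _ (fsing (lmuls gc t) - fsing t)).
  + by rewrite /= add0r subrr rpred0.
  + by rewrite /= addr0 subrr rpred0.
  + by rewrite /= addr0 sub0r rpredN aug_sing.
Qed.

(** Simple connectedness: around each vertex the path is a coboundary, so the
    path of every defining relation is filled. *)
Lemma path_congr u v : word_congr rels u v ->
  forall s, path s u - path s v \in filled.
Proof.
elim=> {u v} [u|u v _ IH|u v w _ IH1 _ IH2|u u' v v' _ IHu cv IHv|i e|w wr] s.
- by rewrite subrr rpred0.
- by rewrite -rpredN opprB.
- by rewrite -[path s u](subrK (path s v)) -addrA rpredD.
- have vE : word_val rels v' = word_val rels v.
    by apply/presented_eqP; exact: WSym.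
  by rewrite !path_cat vE opprD addrACA rpredD.
- rewrite /= !add0r subr0 word_val_letter; last exact: gen_invol.
  rewrite word_val_nil lmuls1 /step; case: eqP => [->|_]; last by rewrite addr0 rpred0.
  rewrite -lmulsM gcc lmuls1; set d := _ + _.
  have -> : d = 0 by congr (_, _, _); rewrite /= ?addr0 //; freeg_ring.
  exact: rpred0.
- rewrite /= subr0; have w1 := word_val_rel wr.
  have bc := @path_bc s w; have ca := @path_ca s w; have ab := @path_ab s w.
  rewrite w1 lmuls1 subrr subr0 in bc ca.
  have all_exp P (x : word 'I_3) n : all P x -> all P (word_exp x n).
    move=> Px; rewrite /word_exp; elim: n => //= n IHn.
    by rewrite all_cat Px.
  have [nab nbc nac] := letter_neq.
  have nba := nab; have ncb := nbc; have nca := nac.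
  rewrite eq_sym in nba; rewrite eq_sym in ncb; rewrite eq_sym in nca.
  rewrite !inE in wr; case/or4P: wr => [/eqP|/eqP|/eqP|/or3P[]/eqP] wE.
  + rewrite ab; first exact: rpred0.
    by rewrite wE all_exp //= nac.
  + rewrite ab; first exact: rpred0.
    by rewrite wE all_exp //= nbc.
  + by apply: bc; rewrite wE all_exp //= nca.
  + rewrite ab; first exact: rpred0.
    by rewrite wE all_exp //= nac nbc.
  + by apply: bc; rewrite wE all_exp //= nba nca.
  + by apply: ca; rewrite wE all_exp //= ncb nab.
Qed.

(** All translates of s by elements of G have the same value here, which serves
    as the starting point of the paths that lead to them. *)
Definition base (s : seq grp) : seq grp := lmuls (head 1%g s)^-1 s.
Definition path_to (s : seq grp) : edges := path (base s) (repr (head 1%g s)).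

Lemma path_to_step i s :
  path_to (lmuls (gen rels i) s) - path_to s - step i s \in filled.
Proof.
case: s => [|g s].
  rewrite subrr sub0r rpredN /step; case: eqP => _; last exact: rpred0.
  by rewrite subrr rpred0.
have baseE : base (lmuls (gen rels i) (g :: s)) = base (g :: s).
  by rewrite /base -lmulsM [head _ _]/= invgM mulgVK.
rewrite /path_to baseE /=; set t := base _.
have tE : lmuls (word_val rels (repr g)) t = g :: s.
  by rewrite word_val_repr /t /base -lmulsM [head _ _]/= mulgV lmuls1.
have pathE : path t ((i, false) :: repr g) = path t (repr g) + step i (g :: s).
  by rewrite -[in RHS]tE.
rewrite -addrA -opprD -pathE; apply: path_congr; apply/presented_eqP.
rewrite -[LHS]/(word_val _ _) -[RHS]/(word_val _ _) word_val_repr.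
by rewrite word_val_cons ?word_val_repr //; exact: gen_invol.
Qed.

(** The path from the base triangle to s, prolonged to the other two vertices of
    s along its b-edge and its a-edge, gives a map from the vertex modules to edge
    chains modulo filled ones.  Applying it to the three given differences yields
    the family (ea - ec, eb - ec, 0), which is therefore filled. *)
Theorem coxeter_triangle_exact (ea eb ec : chain) :
  eb - ea \in aug2 ga gb -> ec - eb \in aug2 gb gc -> ea - ec \in aug2 gc ga ->
  exists m : chain,
    [/\ ea - m \in aug1 ga, eb - m \in aug1 gb & ec - m \in aug1 gc].
Proof.
pose sab : chain -> edges := fglift path_to.
pose sbc : chain -> edges := fglift (fun s => path_to s - (0, fsing s, 0)).
pose sca : chain -> edges := fglift (fun s => path_to s + (fsing s, 0, 0)).
have sbcE m : sbc m = sab m - (0, m, 0).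
  elim/freeg_span: m => [|k s m IH]; rewrite /sbc /sab ?linear0 ?addr0 //.
  rewrite !linearP /= !fglift_sing -/(sbc m) IH scalerBr addrACA -opprD.
  by congr (_ - (_, _, _)); rewrite /= ?scaler0 ?addr0.
have scaE m : sca m = sab m + (m, 0, 0).
  elim/freeg_span: m => [|k s m IH]; rewrite /sca /sab ?linear0 ?addr0 //.
  rewrite !linearP /= !fglift_sing -/(sca m) IH scalerDr addrACA.
  by congr (_ + (_, _, _)); rewrite /= ?scaler0 ?addr0.
have [nab nbc nac] := letter_neq.
have stepE i g s d : g = gen rels i -> step i s + d \in filled ->
    path_to (lmuls g s) - path_to s + d \in filled.
  move=> -> id; rewrite -[_ - _](subrK (step i s)) -addrA.
  by rewrite rpredD // path_to_step.
move=> ab bc ca.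
have fab : sab (eb - ea) \in filled.
  move: ab; apply: aug_linear => g s /= gE; rewrite /sab !fglift_sing -[_ - _]addr0.
  case: gE => <-; [apply: (@stepE ia ga)|apply: (@stepE ib gb)] => //;
    by rewrite addr0 /step ?nac ?nbc rpred0.
have fbc : sbc (ec - eb) \in filled.
  move: bc; apply: aug_linear => g s /= gE; rewrite /sbc !fglift_sing.
  rewrite opprD addrACA opprK.
  case: gE => <-; [apply: (@stepE ib gb)|apply: (@stepE ic gc)] => //; rewrite /step.
    rewrite nbc add0r addrC; apply: filled0; rewrite /= ?subr0 ?rpred0 //.
    by rewrite -opprB rpredN aug_sing.
  rewrite eqxx; set d := _ + _; have -> : d = 0.
    by congr (_, _, _); rewrite /= ?subr0 ?addr0 //; freeg_ring.
  exact: rpred0.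
have fca : sca (ea - ec) \in filled.
  move: ca; apply: aug_linear => g s /= gE; rewrite /sca !fglift_sing.
  rewrite opprD addrACA.
  case: gE => <-; [apply: (@stepE ic gc)|apply: (@stepE ia ga)] => //; rewrite /step.
    rewrite eqxx; apply: (@filledE _ _ _ (fsing (lmuls gc s) - fsing s)).
    + by rewrite /= add0r subrr rpred0.
    + by rewrite /= subrr addr0 subrr rpred0.
    + by rewrite /= subrr addr0 sub0r rpredN aug_sing.
  rewrite nac add0r; apply: filled0; rewrite /= ?subrr ?rpred0 //.
  exact: aug_sing.
have : sab (eb - ea) + sbc (ec - eb) + sca (ea - ec) \in filled.
  by rewrite rpredD // rpredD.
rewrite sbcE scaE addrA.
have -> : sab (eb - ea) + (sab (ec - eb) - (0, ec - eb, 0)) + sab (ea - ec) +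
    (ea - ec, 0, 0) = (ea - ec, eb - ec, 0).
  have sab0 : sab (eb - ea) + sab (ec - eb) + sab (ea - ec) = 0.
    rewrite /sab -!linearD /=.
    have -> : eb - ea + (ec - eb) + (ea - ec) = 0 by freeg_ring.
    exact: linear0.
  rewrite addrA [X in X + _](addrAC) sab0 add0r.
  by congr (_, _, _); rewrite /= ?subr0 ?add0r ?oppr0 ?addr0 //; freeg_ring.
case/asboolP => m /= [am bm cm]; exists (ec + m).
by split; rewrite opprD addrA // subrr.
Qed.

End CoxeterComplex.

(** * Geometric representation and orders of the rotations *)

Section GeometricRepresentation.
Variable C : fieldType.
Variable z : nat -> C.

Notation vec := 'rV[C]_3.
Notation e i := (delta_mx 0 i : vec).

(** The Coxeter form: its entries off the diagonal are - 2 cos (pi / m), with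
    2 cos (pi / m) written as x + x^-1 for a primitive 2m-th root of unity x.  The sum
    i + j identifies the pair {i, j}: 1, 3 and 2 stand for the orders p, q and r. *)
Definition gram : 'M[C]_3 :=
  \matrix_(i, j) (if i == j then 2%:R else - (z (i + j) + (z (i + j))^-1)).

Definition refl (i : 'I_3) (v : vec) : vec := v - (v *m gram) 0 i *: e i.

Lemma refl_linear i : linear (refl i).
Proof.
move=> k u v; rewrite /refl mulmxDl -scalemxAl !mxE scalerDl opprD addrACA.
by rewrite scalerBr scalerA.
Qed.
HB.instance Definition _ i := GRing.isLinear.Build C vec vec _ (refl i) (refl_linear i).

Lemma reflE i j : refl i (e j) = e j - gram j i *: e i.
Proof. by rewrite /refl -rowE mxE. Qed.

Lemma gramii i : gram i i = 2%:R.
Proof. by rewrite mxE eqxx. Qed.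

Lemma reflK i v : refl i (refl i v) = v.
Proof.
have -> : refl i v = v - (v *m gram) 0 i *: e i by [].
rewrite linearB linearZ /= reflE gramii /refl.
by set c := _ 0 i; apply/rowP => k; rewrite !mxE; ring.
Qed.

Definition rep (w : seq ('I_3 * bool)) (v : vec) : vec :=
  foldr (fun l => refl l.1) v w.

Lemma rep_cat u w v : rep (u ++ w) v = rep u (rep w v).
Proof. exact: foldr_cat. Qed.

Lemma rep_exp u k v : rep (word_exp u k) v = iter k (rep u) v.
Proof.
rewrite /word_exp; elim: k => //= k IH.
by rewrite rep_cat IH.
Qed.

Section Pair.
Variables (i j : 'I_3) (m : nat).
Hypotheses (neq_ij : i != j) (m_gt1 : (1 < m)%N).
Let y := z (i + j).
Hypothesis y_prim : (m.*2).-primitive_root y.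

Definition rot : vec -> vec := refl i \o refl j.
HB.instance Definition _ := GRing.Linear.on rot.

Let y_neq0 : y != 0.
Proof.
apply/eqP => y0; have /eqP := prim_expr_order y_prim.
by rewrite y0 expr0n double_eq0 (gtn_eqF (ltnW m_gt1)) eq_sym oner_eq0.
Qed.

Let y2_neq1 : y ^+ 2 != 1.
Proof.
rewrite -(prim_order_dvd y_prim) gtnNdvd // -[2%N]/(1.*2) ltn_double.
by [].
Qed.

(** The vectors e_i + x e_j with x = y or x = y^-1 are eigenvectors; they are
    independent even for m = 2, when both eigenvalues are -1. *)
Lemma rot_eigen x : (x == y) || (x == y^-1) ->
  rot (e i + x *: e j) = x ^- 2 *: (e i + x *: e j).
Proof.
move=> xy; have x0 : x != 0 by case/orP: xy => /eqP ->; rewrite ?invr_eq0.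
have gE : gram i j = - (x + x^-1) /\ gram j i = - (x + x^-1).
  rewrite !mxE [j == i]eq_sym (negbTE neq_ij) [(j + i)%N]addnC -/y.
  by case/orP: xy => /eqP ->; rewrite // invrK addrC.
have [gij gji] := gE.
have -> : rot (e i + x *: e j) = refl i (e i + x^-1 *: e j).
  rewrite /rot /=; congr (refl i _).
  rewrite linearD linearZ /= !reflE gramii gij.
  by apply/rowP => k; rewrite !mxE; field.
rewrite linearD linearZ /= !reflE gramii gji.
by apply/rowP => k; rewrite !mxE; field.
Qed.

Lemma iter_rot_eigen x k : (x == y) || (x == y^-1) ->
  iter k rot (e i + x *: e j) = x ^- 2 ^+ k *: (e i + x *: e j).
Proof.
move=> xy; elim: k => [|k IH]; first by rewrite scale1r.
by rewrite iterS IH linearZ /= rot_eigen // scalerA -exprSr.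
Qed.

Lemma sum_eigen x : (x == y) || (x == y^-1) -> \sum_(t < m) x ^- 2 ^+ t = 0.
Proof.
move=> xy; have x2 : x ^- 2 != 1 /\ x ^- 2 ^+ m = 1.
  have y2m : y ^+ 2 ^+ m = 1 by rewrite -exprM mul2n (prim_expr_order y_prim).
  by case/orP: xy => /eqP ->; rewrite ?exprVn ?invrK ?invr_eq1 ?y2_neq1 ?y2m ?invr1.
have /eqP := subrX1 (x ^- 2) m; rewrite x2.2 subrr eq_sym mulf_eq0 subr_eq0.
by rewrite (negbTE x2.1) => /eqP.
Qed.

(** rot v - v lies in the plane of the two eigenvectors, whose eigenvalues are
    nontrivial m-th roots of unity: their powers sum to 0. *)
Lemma rot_iter v : iter m rot v = v.
Proof.
pose up := e i + y *: e j; pose um := e i + y^-1 *: e j.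
have [al [be dE]] : exists al be, rot v - v = al *: up + be *: um.
  have [A [B ->]] : exists A B, rot v - v = A *: e i + B *: e j.
    rewrite /rot /= {2}/refl; set b := _ 0 j; rewrite /refl; set a := _ 0 i.
    by exists (- a), (- b); apply/rowP => k; rewrite !mxE; ring.
  have y21 : y - y^-1 != 0.
    by rewrite subr_eq0 -(inj_eq (mulfI y_neq0)) mulfV // -expr2.
  pose D := (y - y^-1)^-1.
  exists (A * (1 - y * D) + B * D), (A * y * D - B * D).
  have yD : y^-1 = y - D^-1 by rewrite /D invrK; ring.
  have D0 : D != 0 by rewrite invr_eq0.
  by apply/rowP => k; rewrite /um yD !mxE; field.
have iterE k : iter k rot v = v + \sum_(t < k) iter t rot (rot v - v).
  elim: k => [|k IH]; first by rewrite big_ord0 addr0.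
  rewrite big_ord_recr /= addrA -IH.
  have -> u w : iter k rot (u - w) = iter k rot u - iter k rot w.
    by elim: k {IH} => //= k ->; rewrite linearB.
  by rewrite addrC subrK -iterSr.
rewrite iterE.
have -> : \sum_(t < m) iter t rot (rot v - v) =
    (al * \sum_(t < m) y ^- 2 ^+ t) *: up +
    (be * \sum_(t < m) y^-1 ^- 2 ^+ t) *: um.
  rewrite !mulr_sumr !scaler_suml -big_split; apply: eq_bigr => t _.
  rewrite dE; elim: (t : nat) => [|t' IH] /=.
    by rewrite !expr0 !mulr1.
  rewrite IH linearD !linearZ /= !rot_eigen ?eqxx ?orbT //.
  by rewrite !scalerA !exprSr !mulrA.
by rewrite !sum_eigen ?eqxx ?orbT // !mulr0 !scale0r !addr0.
Qed.

Lemma rot_order k : (forall v, iter k rot v = v) -> (m %| k)%N.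
Proof.
move=> rotk; have /eqP := rotk (e i + y *: e j).
rewrite iter_rot_eigen ?eqxx //.
move=> /eqP/rowP/(_ i); rewrite !mxE !eqxx (negbTE neq_ij) mulr0 addr0 mulr1.
rewrite exprVn => yk1; have /eqP : y ^+ (2 * k) = 1.
  by apply: invr_inj; rewrite invr1 exprM.
by rewrite -(prim_order_dvd y_prim) -mul2n dvdn_pmul2l.
Qed.
End Pair.

Section Relations.
Variables (p q r : nat).
Hypotheses (p_gt1 : (1 < p)%N) (q_gt1 : (1 < q)%N) (r_gt1 : (1 < r)%N).
Hypotheses (zp : (p.*2).-primitive_root (z 1)) (zq : (q.*2).-primitive_root (z 3))
  (zr : (r.*2).-primitive_root (z 2)).

Lemma rep_congr u w : word_congr (triangle_rels p q r) u w ->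
  forall v, rep u v = rep w v.
Proof.
elim=> {u w} [//|u w _ IH|u w x _ IH1 _ IH2|u u' w w' _ IHu _ IHw|i s|w wr] v.
- by rewrite IH.
- by rewrite IH1.
- by rewrite !rep_cat IHw IHu.
- exact: reflK.
have inE3 k : (k < 3)%N -> (inord k : 'I_3) = k :> nat by move=> ?; rewrite inordK.
rewrite !inE in wr; case/or4P: wr => [/eqP|/eqP|/eqP|/or3P[]/eqP] ->;
  rewrite rep_exp; try exact: reflK.
- by apply: (@rot_iter (inord 0) (inord 1)); rewrite -?val_eqE /= ?inE3.
- by apply: (@rot_iter (inord 1) (inord 2)); rewrite -?val_eqE /= ?inE3.
- by apply: (@rot_iter (inord 2) (inord 0)); rewrite -?val_eqE /= ?inE3.
Qed.
End Relations.
End GeometricRepresentation.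

Section TriangleGroupOrders.
Variables (p q r : nat).
Hypotheses (p_gt1 : (1 < p)%N) (q_gt1 : (1 < q)%N) (r_gt1 : (1 < r)%N).
Notation rels := (triangle_rels p q r).

Lemma word_val_pair_exp (i j : 'I_3) k : ((gen rels i * gen rels j) ^+ k)%g =
  word_val rels (word_exp [:: (i, false); (j, false)] k).
Proof.
rewrite -word_val_cat /word_exp; elim: k => [|l IH] //=.
by rewrite expgS IH -word_val_cat.
Qed.

(** A relation in G holds in the geometric representation, where the rotation
    has exactly the prescribed order. *)
Lemma triangle_orders k :
  [/\ ((ga p q r * gb p q r) ^+ k = 1)%g -> (p %| k)%N,
       ((gb p q r * gc p q r) ^+ k = 1)%g -> (q %| k)%N &
       ((gc p q r * ga p q r) ^+ k = 1)%g -> (r %| k)%N].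
Proof.
have dbl m : (1 < m)%N -> (0 < m.*2)%N by rewrite double_gt0 => /ltnW.
have [zp prim_p] := C_prim_root_exists (dbl p p_gt1).
have [zq prim_q] := C_prim_root_exists (dbl q q_gt1).
have [zr prim_r] := C_prim_root_exists (dbl r r_gt1).
pose z n := nth 1 [:: 1; zp; zr; zq] n.
have inE3 l : (l < 3)%N -> (inord l : 'I_3) = l :> nat by move=> ?; rewrite inordK.
have rep1 i j : ((gen rels i * gen rels j) ^+ k = 1)%g ->
    forall v, iter k (rot z i j) v = v.
  rewrite word_val_pair_exp => /presented_eqP /(@rep_congr _ z) repw v.
  by have := repw p_gt1 q_gt1 r_gt1 prim_p prim_q prim_r v; rewrite rep_exp.
split=> /rep1 rotk.
- by apply: (@rot_order _ z (inord 0) (inord 1)) rotk; rewrite -?val_eqE /= ?inE3.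
- by apply: (@rot_order _ z (inord 1) (inord 2)) rotk; rewrite -?val_eqE /= ?inE3.
- by apply: (@rot_order _ z (inord 2) (inord 0)) rotk; rewrite -?val_eqE /= ?inE3.
Qed.

(** All relators have even length. *)
Lemma word_congr_parity u v : word_congr rels u v -> odd (size u) = odd (size v).
Proof.
elim=> {u v} [//|//|u v w _ -> _ -> //|u u' v v' _ IHu _ IHv|//|w wr].
  by rewrite !size_cat !oddD IHu IHv.
have even_exp k (x : word 'I_3) : odd (size (word_exp x k)) = odd k && odd (size x).
  by rewrite /word_exp; elim: k => //= k IH; rewrite size_cat oddD IH; case: odd; case: odd.
rewrite !inE in wr; case/or4P: wr => [/eqP|/eqP|/eqP|/or3P[]/eqP] ->;
  by rewrite even_exp //= andbF.
Qed.

Lemma word_val_parity u v : word_val rels u = word_val rels v ->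
  odd (size u) = odd (size v).
Proof. by move/presented_eqP/word_congr_parity. Qed.

Lemma triangle_rotations :
  [/\ ((ga p q r * gb p q r) ^+ p = 1)%g, ((gb p q r * gc p q r) ^+ q = 1)%g &
       ((gc p q r * ga p q r) ^+ r = 1)%g].
Proof.
by split; rewrite word_val_pair_exp; apply: word_val_rel; rewrite !inE eqxx ?orbT.
Qed.
End TriangleGroupOrders.

(** * Dihedral subgroups *)

Section DihedralPairs.

(** Two involutions that generate a dihedral group of order 2m: the last condition
    keeps x out of the rotation subgroup. *)
Definition dihedral_pair (G : groupType) (m : nat) (x y : G) :=
  [/\ (x * x = 1)%g, (y * y = 1)%g,
      forall k, ((x * y) ^+ k = 1)%g <-> (m %| k)%N &
      forall k, ((x * y) ^+ k <> x)%g].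

Definition alt_word (G : groupType) (x y : G) (w : seq bool) : G :=
  foldr (fun e g => ((if e then x else y) * g)%g) 1%g w.

Lemma alt_word_cat (G : groupType) (x y : G) u v :
  alt_word x y (u ++ v) = (alt_word x y u * alt_word x y v)%g.
Proof. by elim: u => [|e u IH] /=; rewrite ?mul1g // IH mulgA. Qed.

Lemma alt_word_rev (G : groupType) (x y : G) w : (x * x = 1)%g ->
  (y * y = 1)%g -> alt_word x y (rev w) = (alt_word x y w)^-1%g.
Proof.
move=> xx yy; elim: w => [|e w IH] /=; first by rewrite invg1.
rewrite rev_cons -cats1 alt_word_cat IH invgM /= mulg1; congr (_ * _)%g.
by case: e; [apply: (@mulgI _ x) | apply: (@mulgI _ y)]; rewrite mulgV.
Qed.

(** Exponents (i, j) with w = (x y)^i x^j for all pairs of involutions whose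
    product has order dividing m; multiplication by m.-1 stands for inversion. *)
Fixpoint normal_form (m : nat) (w : seq bool) : nat * bool :=
  if w is e :: w' then
    let ij := normal_form m w' in
    (((if e then ij.1 else ij.1.+1) * m.-1)%N, ~~ ij.2)
  else (0%N, false).

Lemma alt_word_normal (G : groupType) m (x y : G) w : (0 < m)%N ->
  dihedral_pair m x y ->
  alt_word x y w = ((x * y) ^+ (normal_form m w).1 * x ^+ (normal_form m w).2)%g.
Proof.
move=> m_gt0 [xx yy ordxy _]; elim: w => [|e w IH] /=; first by rewrite mulg1.
have xV : x^-1%g = x by apply: (@mulgI _ x); rewrite mulgV.
have yV : y^-1%g = y by apply: (@mulgI _ y); rewrite mulgV.
have flip i : (x * (x * y) ^+ i = (x * y) ^+ (i * m.-1) * x)%g.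
  have -> : ((x * y) ^+ (i * m.-1) = (y * x) ^+ i)%g.
    have /ordxy xym : (m %| m)%N by [].
    rewrite mulnC expgM; congr (_ ^+ i)%g; apply: (@mulgI _ (x * y)%g).
    by rewrite -expgS prednK // xym -mulgA (mulgA y) yy mul1g xx.
  elim: i => [|i IHi]; first by rewrite !expg0 mulg1 mul1g.
  by rewrite expgSr mulgA IHi expgSr -!mulgA xx mulg1 (mulgA x) xx mul1g.
set ij := normal_form m w in IH *.
have -> : ((if e then x else y) * alt_word x y w =
    x * (x * y) ^+ (if e then ij.1 else ij.1.+1) * x ^+ ij.2)%g.
  rewrite IH; case: e => //; first by rewrite mulgA.
  by rewrite expgS !mulgA xx mul1g.
rewrite flip -mulgA; congr (_ * _)%g.
by case: (ij.2) => /=; rewrite ?expg1 ?xx ?expg0 ?mulg1.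
Qed.

(** Whether a word is trivial can be read off its normal form, hence does not
    depend on the group: this identifies any two dihedral groups of order 2m. *)
Lemma alt_word_eq1 (G : groupType) m (x y : G) w : (0 < m)%N ->
  dihedral_pair m x y ->
  alt_word x y w = 1%g <-> (m %| (normal_form m w).1)%N && ~~ (normal_form m w).2.
Proof.
move=> m_gt0 dxy; rewrite (alt_word_normal _ m_gt0 dxy).
have [xx _ ordxy xyx] := dxy; case: normal_form => i [] /=.
  rewrite andbF expg1; split=> // xyi; case: (xyx i).
  by apply: (@mulIg _ x); rewrite xyi xx.
by rewrite expg0 mulg1 andbT; apply: ordxy.
Qed.

Lemma dihedral_pair_embedding (H G : groupType) m (s t : H) (x y : G) :
  (0 < m)%N -> dihedral_pair m s t -> dihedral_pair m x y ->
  (forall h, exists w, h = alt_word s t w) ->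
  exists phi : H -> G, [/\ {morph phi : g h / (g * h)%g}, injective phi,
    phi s = x & phi t = y].
Proof.
move=> m_gt0 dst dxy gen_st.
have [ss tt _ _] := dst; have [xx yy _ _] := dxy.
have same u v : alt_word s t u = alt_word s t v <->
    alt_word x y u = alt_word x y v.
  have eq1 (K : groupType) (g h : K) : (g * g = 1)%g -> (h * h = 1)%g ->
      alt_word g h u = alt_word g h v <-> alt_word g h (u ++ rev v) = 1%g.
    move=> gg hh; rewrite alt_word_cat alt_word_rev //; split=> [->|E].
      by rewrite mulgV.
    by rewrite -[LHS](mulgKV (alt_word g h v)) E mul1g.
  by rewrite eq1 // (eq1 _ x y) // !(alt_word_eq1 _ m_gt0 dst, alt_word_eq1 _ m_gt0 dxy).
have gen_st' h : exists w, h == alt_word s t w.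
  by have [w ->] := gen_st h; exists w.
pose word_of h := xchoose (gen_st' h).
have word_ofE h : alt_word s t (word_of h) = h.
  by apply/esym/eqP/(xchooseP (gen_st' h)).
have phiE w : alt_word x y (word_of (alt_word s t w)) = alt_word x y w.
  by apply/same; rewrite word_ofE.
exists (fun h => alt_word x y (word_of h)); split.
- move=> g h; rewrite -alt_word_cat; apply/same.
  by rewrite alt_word_cat !word_ofE.
- by move=> g h /same; rewrite !word_ofE.
- by have := phiE [:: true]; rewrite /= !mulg1.
- by have := phiE [:: false]; rewrite /= !mulg1.
Qed.

(** If x is a generating rotation and y a reflection, then y and y x are two
    reflections with product x. *)
Lemma dihedral_group_pair m : (1 < m)%N ->
  exists s t : dihedral_group m, dihedral_pair m s t /\
    forall h, exists w, h = alt_word s t w.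
Proof.
move=> m_gt1; have := Grp_dihedral m_gt1.
case/(isoGrpP _)/(_ (isog_refl _)) => _ /existsP[[x y]] /=.
case/eqP => defG xm y2 xy.
have defD : (<[x]> * <[y]> = [set: 'D_(m.*2)])%g.
  by rewrite -norm_joinEr // norms_cycle xy groupV cycle_id.
have cD := card_dihedral m_gt1; rewrite -defD in cD.
have yy : (y * y = 1)%g := y2.
have notXy : y \notin <[x]>%g.
  apply/negP => Xy; have : (m.*2 <= m)%N.
    have <- : #|(<[x]> * <[y]>)%g| = m.*2 by exact: cD.
    rewrite mulGSid ?cycle_subG //.
    by rewrite dvdn_leq ?(ltnW m_gt1) // order_dvdn xm.
  by rewrite -addnn -{3}[m]addn0 leq_add2l leqn0 -(negbK (m == 0)) -lt0n ltnW.
have ox : #[x]%g = m.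
  apply/eqP; rewrite eqn_leq dvdn_leq ?order_dvdn ?xm ?(ltnW m_gt1) //=.
  rewrite -leq_double; apply: (@leq_trans #|(<[x]> * <[y]>)%g|).
    by rewrite cD.
  rewrite -[leqRHS]muln2.
  have oy : (#[y]%g <= 2)%N by rewrite dvdn_leq // order_dvdn y2.
  apply: leq_trans (leq_mul (leqnn #[x]%g) oy).
  by rewrite [leqRHS]mul_cardG leq_pmulr // cardG_gt0.
exists y, (y * x)%g; split; last first.
  move=> h; have : h \in (<[x]> * <[y]>)%g by rewrite defD inE.
  case/mulsgP => _ _ /cycleP[i ->] /cycleP[j ->] ->.
  exists (flatten (nseq i [:: true; false]) ++ nseq j true).
  rewrite alt_word_cat; congr (_ * _)%g.
    by elim: i => //= i IH; rewrite -IH expgS !mulgA yy mul1g.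
  by elim: j => //= j IH; rewrite -IH expgS.
have yyx : (y * (y * x) = x)%g by rewrite mulgA yy mul1g.
have yV : (y^-1 = y)%g by apply: (@mulgI _ y); rewrite mulgV yy.
split=> //.
- by rewrite mulgA -[(y * x * y)%g]mulgA -{1}yV -conjgE xy mulVg.
- move=> k; rewrite yyx -[in X in _ <-> X]ox order_dvdn.
  by split=> [->|/eqP].
- move=> k; rewrite yyx => xk; case/negP: notXy.
by rewrite -xk mem_cycle.
Qed.

End DihedralPairs.

(** * Euler characteristic of a finite triangle group *)

Section FiniteEulerCharacteristic.
Variables (G : groupType) (s : seq G).
Hypotheses (s_uniq : uniq s) (s_all : forall g, g \in s).

Notation N := (size s).
Notation row := 'rV[rat]_N.
Notation el i := (nth 1%g s (i : 'I_N)).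

Lemma index_lt g : (index g s < N)%N. Proof. by rewrite index_mem. Qed.
Definition pos g : 'I_N := Ordinal (index_lt g).

Lemma posK g : el (pos g) = g. Proof. exact: nth_index. Qed.
Lemma elK (i : 'I_N) : pos (el i) = i.
Proof. by apply/val_inj; rewrite /= index_uniq. Qed.

(** Left translation by g on row vectors indexed by the elements of G. *)
Definition lmul_mx (g : G) : 'M[rat]_N :=
  \matrix_(i, j) (j == pos (g * el i)%g)%:R.

Definition diff_mx g : 'M[rat]_N := lmul_mx g - 1%:M.

Section OneInvolution.
Variables (g : G) (gg : (g * g = 1)%g).

Lemma mul_lmul_mx (v : row) x : (v *m lmul_mx g) 0 (pos x) = v 0 (pos (g * x)%g).
Proof.
rewrite mxE (bigD1 (pos (g * x)%g)) //= !mxE posK mulgA gg mul1g !eqxx mulr1.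
rewrite big1 ?addr0 // => i; rewrite !mxE => neq_i.
case: eqP => [xi|_]; last by rewrite mulr0.
case/eqP: neq_i; rewrite -[i]elK; congr pos; apply: (@mulgI _ g).
by rewrite -[LHS]posK -xi posK mulgA gg mul1g.
Qed.

Lemma diff_mx_anti (v : row) : (v <= diff_mx g)%MS -> v *m lmul_mx g = - v.
Proof.
case/submxP => u ->.
have diffE x : (u *m diff_mx g) 0 (pos x) = u 0 (pos (g * x)%g) - u 0 (pos x).
  by rewrite mulmxBr mulmx1 -mul_lmul_mx !mxE.
apply/rowP => i; rewrite -[i]elK mul_lmul_mx [RHS]mxE !diffE mulgA gg mul1g.
by rewrite opprB.
Qed.

Lemma anti_diff_mx (v : row) : v *m lmul_mx g = - v -> (v <= diff_mx g)%MS.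
Proof.
move=> vg; apply/submxP; exists (- 2%:R^-1 *: v).
rewrite -scalemxAl mulmxBr mulmx1 vg.
by apply/rowP => i; rewrite !mxE; field.
Qed.

Lemma anti_diffP (v : row) :
  reflect (forall x, v 0 (pos (g * x)%g) = - v 0 (pos x)) (v <= diff_mx g)%MS.
Proof.
apply: (iffP idP) => [/diff_mx_anti vg x|vg].
  by rewrite -mul_lmul_mx vg mxE.
by apply: anti_diff_mx; apply/rowP => i; rewrite -[i]elK mul_lmul_mx vg mxE.
Qed.

End OneInvolution.

Lemma diff_mx_sum0 g : diff_mx g *m (const_mx 1 : 'cV_N) = 0.
Proof.
apply/colP => i; rewrite mulmxBl mul1mx !mxE (bigD1 (pos (g * el i)%g)) //=.
rewrite !mxE eqxx mulr1 big1 ?addr0 ?subrr // => j /negbTE neq_j.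
by rewrite !mxE neq_j mul0r.
Qed.

Section SignFunction.
Variable sgn : G -> rat.
Hypothesis sgn_neq0 : forall x, sgn x != 0.

(** The sign character conjugates the translation by g into its opposite, so
    the translation plus 1 and minus 1 have the same rank; together they span
    everything. *)
Lemma rank_diff_mx g : (g * g = 1)%g -> (forall x, sgn (g * x)%g = - sgn x) ->
  (N <= (\rank (diff_mx g)).*2)%N.
Proof.
move=> gg sgng; pose D := diag_mx (\row_i sgn (el i)).
pose E := diag_mx (\row_i (sgn (el i))^-1).
have DE : D *m E = 1%:M.
  rewrite mulmx_diag; apply/matrixP => i j; rewrite !mxE.
  by rewrite mulfV.
have sumE : lmul_mx g + 1%:M = - (D *m diff_mx g *m E).
  rewrite mulmxBr mulmx1 mulmxBl DE opprB addrC; congr (_ + _).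
  apply/matrixP => i j; rewrite mul_mx_diag mul_diag_mx !mxE.
  case: eqP => [->|_]; last by rewrite mulr0 mul0r oppr0.
  by rewrite posK sgng mulr1 invrN mulrN mulfV ?opprK.
have : (\rank (lmul_mx g + 1%:M)%R <= \rank (diff_mx g))%N.
  by rewrite sumE mxrank_opp (leq_trans (mxrankM_maxl _ _)) // mxrankM_maxr.
rewrite -addnn => le_rank.
apply: leq_trans (leq_add le_rank (leqnn _)).
have : (1%:M <= (lmul_mx g + 1%:M)%R + diff_mx g)%MS.
  have oneE : 1%:M = 2%:R^-1 *: (lmul_mx g + 1%:M - diff_mx g).
    by apply/matrixP => i j; rewrite !mxE; field.
  by rewrite {1}oneE; apply: scalemx_sub; apply: addmx_sub_adds => //; rewrite eqmx_opp.
move/mxrankS; rewrite mxrank1 => /leq_trans; apply.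
exact: mxrank_adds_leqif.
Qed.
End SignFunction.

Section OrbitBound.
Variables (H : finGroupType) (phi : H -> G) (a b : G).
Hypotheses (aa : (a * a = 1)%g) (bb : (b * b = 1)%g).
Hypotheses (phiM : {morph phi : x y / (x * y)%g}) (phi_inj : injective phi).
Hypothesis phi_word : forall h, exists w, phi h = alt_word a b w.

(** A vector negated by a and b is determined by one coordinate in each orbit of
    the subgroup that they generate, and all orbits have #|H| elements. *)
Lemma rank_orbit : (\rank (diff_mx a :&: diff_mx b)%MS * #|H| <= N)%N.
Proof.
pose e (i j : 'I_N) := [exists h, el j == (phi h * el i)%g].
have phi_1 := mul_morph1 phiM; have phi_V := mul_morphV phiM.
have e_equiv : {in [set: 'I_N] & &, equivalence_rel e}.
  apply: in3W; apply/equivalence_relP; split=> [i|i j /existsP[h /eqP ijE] k].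
    by apply/existsP; exists 1%g; rewrite phi_1 mul1g.
  apply/existsP/existsP => -[h' /eqP kE].
    by exists (h' * h^-1)%g; rewrite kE ijE phiM phi_V -mulgA mulKg.
  by exists (h' * h)%g; rewrite kE ijE phiM mulgA.
pose P := equivalence_partition e [set: 'I_N].
have partP : partition P [set: 'I_N] by exact: equivalence_partitionP.
have blockP B : B \in P -> exists i, B = [set j | e i j].
  by case/imsetP => i _ ->; exists i; apply/setP => j; rewrite !inE.
have cardP : {in P, forall B : {set 'I_N}, #|B| = #|H|}.
  move=> B /blockP[i ->].
  have -> : [set j | e i j] = [set pos (phi h * el i)%g | h : H].
    apply/setP => j; rewrite inE; apply/existsP/imsetP => [[h /eqP jE]|[h _ ->]].
      by exists h; rewrite // -jE elK.
    by exists h; rewrite posK.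
  rewrite card_imset // => h k /(congr1 (fun i => el i)); rewrite !posK.
  by move/mulIg/phi_inj.
have cardN := card_uniform_partition cardP partP; rewrite cardsT card_ord in cardN.
apply: (@leq_trans (#|P| * #|H|)%N); last by rewrite -cardN.
rewrite leq_mul2r; apply/orP; right.
have [io ioP] : exists io : 'I_#|P| -> 'I_N, forall k, io k \in enum_val k.
  suff /fin_all_exists : forall k : 'I_#|P|, exists i, i \in enum_val k by [].
  move=> k; apply/set0Pn.
  case/and3P: partP => _ _; apply: contraNneq => <-; exact: enum_valP.
(* Restriction of row vectors to the chosen representatives of the orbits. *)
pose Q : 'M[rat]_(N, #|P|) := \matrix_(i, k) (i == io k)%:R.
have QE (v : row) k : (v *m Q) 0 k = v 0 (io k).
  rewrite mxE (bigD1 (io k)) //= !mxE eqxx mulr1 big1 ?addr0 // => i.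
  by rewrite !mxE => /negbTE ->; rewrite mulr0.
rewrite -(mxrank_mul_ker _ Q).
suff /eqP -> : ((diff_mx a :&: diff_mx b) :&: kermx Q)%MS == 0.
  by rewrite mxrank0 addn0 rank_leq_col.
apply/rowV0P => v; rewrite !sub_capmx => /andP[/andP[va vb] /sub_kermxP vQ].
have va' := anti_diffP aa _ va; have vb' := anti_diffP bb _ vb.
have vw w x : v 0 (pos x) = 0 -> v 0 (pos (alt_word a b w * x)%g) = 0.
  move=> vx; elim: w => [|t w IH] /=; first by rewrite mul1g.
  by rewrite -mulgA; case: t; rewrite ?va' ?vb' IH oppr0.
apply/rowP => j; rewrite mxE.
have : j \in cover P by rewrite (cover_partition partP) inE.
case/bigcupP => B PB jB; have [i BE] := blockP B PB.
have [k kB] : exists k, io k \in B.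
  by exists (enum_rank_in PB B); have := ioP (enum_rank_in PB B); rewrite enum_rankK_in.
rewrite BE !inE in jB kB.
have eqv := e_equiv i (io k) j (in_setT _) (in_setT _) (in_setT _).
move: jB; rewrite (eqv.2 kB) => /existsP[h /eqP jE].
rewrite -[j]elK jE; have [w ->] := phi_word h.
by apply: vw; rewrite elK -QE vQ mxE.
Qed.
End OrbitBound.

Notation chain := {freeg (seq G) / rat}.

Definition row_chain (v : row) : chain := \sum_i v 0 i *: fsing [:: el i].

Definition chain_row : chain -> row :=
  fglift (fun t => if t is [:: g] then delta_mx 0 (pos g) else 0).
HB.instance Definition _ := GRing.Linear.on chain_row.

Lemma row_chainK v : chain_row (row_chain v) = v.
Proof.
rewrite linear_sum [RHS]row_sum_delta; apply: eq_bigr => i _.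
by rewrite linearZ /= /chain_row fglift_sing elK.
Qed.

Lemma chain_row_trans g m : chain_row (trans g m) = chain_row m *m lmul_mx g.
Proof.
elim/freeg_span: m => [|k t m IH]; first by rewrite !linear0 mul0mx.
rewrite !linearP /= IH mulmxDl -scalemxAl; congr (_ *: _ + _).
rewrite trans_sing /chain_row !fglift_sing.
case: t => [|x [|y t]] /=; rewrite ?mul0mx // -rowE.
by apply/rowP => j; rewrite !mxE eqxx posK.
Qed.

Lemma chain_row_aug g m : (g * g = 1)%g -> m \in aug (eq g) ->
  (chain_row m <= diff_mx g)%MS.
Proof.
move=> gg /(aug_anti gg) gm; apply: anti_diff_mx.
by rewrite -chain_row_trans gm linearN.
Qed.

Lemma row_chain_aug g v : (g * g = 1)%g -> (v <= diff_mx g)%MS ->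
  row_chain v \in aug (eq g).
Proof.
move=> gg /(anti_diffP gg) vg; apply: anti_aug => //.
have pinj : injective (fun i => pos (g * el i)%g).
  move=> i j /(congr1 (fun i => el i)); rewrite !posK => /mulgI /(congr1 pos).
  by rewrite !elK.
rewrite /row_chain linear_sum (reindex_inj pinj) -sumrN; apply: eq_bigr => i _.
by rewrite linearZ /= trans_sing /= posK mulgA gg mul1g vg elK scaleNr.
Qed.

(** Let A, B, C be the spaces of row vectors negated by a, b, c.  Exactness of the
    triangle says that A + (B :&: C) contains (A + B) :&: (A + C), so the ranks satisfy
    r A + r B + r C + r (A :&: B :&: C)
      <= r (A + B + C) + r (A :&: B) + r (B :&: C) + r (C :&: A).
    Here r A, r B, r C are at least N / 2, the triple intersection contains the
    sign character, the sum A + B + C lies in the kernel of the sum of coordinates,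
    and the last three ranks are at most N / 2p, N / 2q, N / 2r. *)
Theorem finite_triangle_excess (a b c : G) (sgn : G -> rat) (p q r : nat) :
  (a * a = 1)%g -> (b * b = 1)%g -> (c * c = 1)%g ->
  (forall ea eb ec : chain,
    eb - ea \in aug (fun g => a = g \/ b = g) ->
    ec - eb \in aug (fun g => b = g \/ c = g) ->
    ea - ec \in aug (fun g => c = g \/ a = g) ->
    exists m : chain, [/\ ea - m \in aug (eq a), eb - m \in aug (eq b) &
      ec - m \in aug (eq c)]) ->
  (forall x, sgn x != 0) -> (forall x, sgn (a * x)%g = - sgn x) ->
  (forall x, sgn (b * x)%g = - sgn x) -> (forall x, sgn (c * x)%g = - sgn x) ->
  (0 < p)%N -> (0 < q)%N -> (0 < r)%N ->
  (\rank (diff_mx a :&: diff_mx b)%MS * p.*2 <= N)%N ->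
  (\rank (diff_mx b :&: diff_mx c)%MS * q.*2 <= N)%N ->
  (\rank (diff_mx c :&: diff_mx a)%MS * r.*2 <= N)%N ->
  (1 < p%:R^-1 + q%:R^-1 + r%:R^-1 :> rat).
Proof.
move=> aa bb cc exactABC sgn0 sgna sgnb sgnc p0 q0 r0.
have ra := rank_diff_mx sgn0 aa sgna.
have rb := rank_diff_mx sgn0 bb sgnb.
have rc := rank_diff_mx sgn0 cc sgnc.
have N_gt0 : (0 < N)%N by apply: leq_ltn_trans (index_lt 1%g).
set A := diff_mx a in ra *; set B := diff_mx b in rb *; set C := diff_mx c in rc *.
have distr : ((A + B) :&: (A + C) <= A + (B :&: C))%MS.
  apply/rV_subP => v; rewrite sub_capmx => /andP[/sub_addsmxP[[u1 u2] /= vAB]].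
  case/sub_addsmxP=> -[u3 u4] /= vAC.
  have chainAB x y u u' : (x * x = 1)%g -> (y * y = 1)%g ->
      v = u *m diff_mx x + u' *m diff_mx y ->
      row_chain v \in aug (fun g => x = g \/ y = g).
    move=> xx yy ->; rewrite /row_chain.
    have -> : \sum_i (u *m diff_mx x + u' *m diff_mx y) 0 i *: fsing [:: el i] =
        row_chain (u *m diff_mx x) + row_chain (u' *m diff_mx y).
      by rewrite -big_split; apply: eq_bigr => i _; rewrite mxE scalerDl.
    apply: rpredD.
      apply: (@aug_sub _ _ (eq x)); first by left.
      by apply: row_chain_aug => //; exact: submxMl.
    apply: (@aug_sub _ _ (eq y)); first by right.
    by apply: row_chain_aug => //; exact: submxMl.
  (* Exactness applied to the differences v, 0 and - v. *)
have [|||m [am bm cm]] := exactABC 0 (row_chain v) (row_chain v).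
  - by rewrite subr0; exact: chainAB vAB.
  - by rewrite subrr rpred0.
  - rewrite sub0r rpredN; apply: (chainAB c a u4 u3) => //.
    by rewrite addrC.
  rewrite -[v](subrK (chain_row m)) addrC; apply: addmx_sub_adds.
    by have := chain_row_aug aa am; rewrite sub0r linearN eqmx_opp.
  have -> : v - chain_row m = chain_row (row_chain v - m).
    by rewrite linearB /= row_chainK.
  by rewrite sub_capmx !chain_row_aug.
have sum_lt : (\rank ((A + B) + (A + C))%MS < N)%N.
  have : ((A + B) + (A + C) <= kermx (const_mx 1 : 'cV[rat]_N))%MS.
    by rewrite !addsmx_sub; do !(apply/andP; split);
      apply/sub_kermxP; exact: diff_mx_sum0.
  move/mxrankS/leq_ltn_trans; apply; rewrite mxrank_ker.
  rewrite -subn_gt0 subKn ?rank_leq_row // lt0n mxrank_eq0.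
  by apply/eqP => /colP/(_ (pos 1%g)); rewrite !mxE => /eqP; rewrite oner_eq0.
have cap_gt0 : (0 < \rank (A :&: (B :&: C))%MS)%N.
  pose v : row := \row_i sgn (el i).
  have v_cap : (v <= A :&: (B :&: C))%MS.
    by rewrite !sub_capmx; do !(apply/andP; split);
      apply/anti_diffP => // x; rewrite !mxE !posK.
  apply: leq_trans (mxrankS v_cap); rewrite rank_rV lt0b.
  by apply/eqP => /rowP/(_ (pos 1%g)); rewrite !mxE => /eqP; exact/negP.
have eAB := mxrank_sum_cap A B; have eAC := mxrank_sum_cap A C.
have eABC := mxrank_sum_cap (A + B)%MS (A + C)%MS.
have eA := mxrank_sum_cap A (B :&: C)%MS.
have eCA : \rank (C :&: A)%MS = \rank (A :&: C)%MS by rewrite capmxC.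
rewrite eCA.
have le_distr := mxrankS distr.
set dAB := \rank (A :&: B) in eAB *; set dAC := \rank (A :&: C) in eAC *.
set dBC := \rank (B :&: C) in eA *.
have key : (N + 4 <= 2 * (dAB + dBC + dAC))%N by lia.
move=> hp hq hr.
have le_inv (k d : nat) : (0 < k)%N -> (d * k.*2 <= N)%N ->
    (2 * d)%:R <= N%:R * k%:R^-1 :> rat.
  move=> k0 dk; rewrite ler_pdivlMr ?ltr0n // -natrM ler_nat.
  by move: dk; rewrite -muln2; lia.
rewrite -(ltr_pM2l (_ : 0 < N%:R :> rat)) ?ltr0n // mulr1 !mulrDr.
apply: lt_le_trans (lerD (lerD (le_inv _ _ p0 hp) (le_inv _ _ q0 hq)) (le_inv _ _ r0 hr)).
rewrite -!natrD ltr_nat.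
lia.
Qed.

End FiniteEulerCharacteristic.

(** * Homology classes *)

Section HomologyClasses.
Variables (R : nzRingType) (U V W : lmodType R).
Variables (f : {linear U -> V}) (g : {linear V -> W}).
Local Open Scope quotient_scope.

Lemma ker_predP v : g v = 0 -> v \in ker_pred g.
Proof. by move=> gv; rewrite inE gv. Qed.

Definition hclass v (gv : g v = 0) : homology_at f g :=
  \pi_(quot_mod (boundary_pred f (g := g))) (Kernel (ker_predP gv)).

Lemma hclassP (x : homology_at f g) : exists v (gv : g v = 0), x = hclass gv.
Proof.
elim/quotW: x => -[v vP]; have gv : g v = 0 by apply/eqP; move: vP; rewrite inE.
by exists v, gv; congr \pi; apply/val_inj.
Qed.

Lemma eq_hclass u v (gu : g u = 0) (gv : g v = 0) :
  hclass gu = hclass gv <-> exists w, f w = u - v.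
Proof.
split=> [/quot_eqP|[w fw]]; first by rewrite inE => /asboolP.
by apply/quot_eqP; rewrite inE; apply/asboolP; exists w.
Qed.

Lemma hclass_linear k u v (gu : g u = 0) (gv : g v = 0)
    (guv : g (k *: u + v) = 0) :
  k *: hclass gu + hclass gv = hclass guv.
Proof.
rewrite [k *: hclass gu]quot_scaleE quot_piD; congr \pi.
by apply/val_inj.
Qed.
End HomologyClasses.

Section HomologyMap.
Variables (R : nzRingType) (U V W U' V' W' : lmodType R).
Variables (f : {linear U -> V}) (g : {linear V -> W}).
Variables (f' : {linear U' -> V'}) (g' : {linear V' -> W'}).
Variable h : {linear V -> V'}.
Hypothesis h_cycle : forall v, g v = 0 -> g' (h v) = 0.
Hypothesis h_boundary : forall u, exists u', f' u' = h (f u).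

Lemma ker_val_eq0 (v : kernel g) : g (ker_val v) = 0.
Proof. by apply/eqP; have := ker_valP v; rewrite inE. Qed.

Definition homology_map (x : homology_at f g) : homology_at f' g' :=
  hclass f' (h_cycle (ker_val_eq0 (repr x))).

Lemma homology_map_class v (gv : g v = 0) (ghv : g' (h v) = 0) :
  homology_map (hclass f gv) = hclass f' ghv.
Proof.
apply/eq_hclass; have /eq_hclass[w fw] :
    hclass f (ker_val_eq0 (repr (hclass f gv))) = hclass f gv.
  rewrite -[RHS]reprK; congr (\pi_(_)%qT _); exact/val_inj.
by rewrite -linearB -fw; exact: h_boundary.
Qed.

Lemma homology_map_linear : linear homology_map.
Proof.
move=> k x y; have [u [gu ->]] := hclassP x; have [v [gv ->]] := hclassP y.
have guv : g (k *: u + v) = 0 by rewrite linearP gu gv scaler0 addr0.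
rewrite (hclass_linear _ _ _ guv) !homology_map_class ?h_cycle // => guv' gu' gv'.
have ghuv : g' (k *: h u + h v) = 0 by rewrite linearP gu' guv' scaler0 addr0.
rewrite (hclass_linear f' gu' guv' ghuv); apply/eq_hclass.
by exists 0; rewrite linear0 linearP subrr.
Qed.
End HomologyMap.
Arguments homology_map {R U V W U' V' W' f g f' g'} h h_cycle x.
Arguments homology_map_linear {R U V W U' V' W' f g f' g'} h h_cycle h_boundary.
Arguments homology_map_class {R U V W U' V' W' f g f' g'} h h_cycle h_boundary v.

(** The comparison is built from the dihedral groups to the triangle group;
    its inverse is automatically linear. *)
Lemma linear_inverse3 (R : nzRingType) (A B C D : lmodType R)
    (f : {linear A -> D}) (g : {linear B -> D}) (h : {linear C -> D}) :
  (forall x y z, f x + g y + h z = 0 -> [/\ x = 0, y = 0 & z = 0]) ->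
  (forall d, exists x y z, f x + g y + h z = d) ->
  exists F : {linear D -> (A * B * C)%type}, bijective F.
Proof.
move=> fgh0 fgh_surj.
pose s (t : A * B * C) := f t.1.1 + g t.1.2 + h t.2.
have sP k t u : s (k *: t + u) = k *: s t + s u.
  rewrite /s /= !linearP /= !scalerDr.
  by rewrite (addrACA (k *: f _)) (addrACA (_ + _) _ (k *: h _)).
have s_inj : injective s.
  move=> [[x y] z] [[x' y'] z'] st.
  have [|/subr0_eq-> /subr0_eq-> /subr0_eq-> //] := fgh0 (x - x') (y - y') (z - z').
  have := sP (-1) (x', y', z') (x, y, z); rewrite st [_ *: s _]scaleN1r addNr => <-.
  by rewrite /s /= !scaleN1r ![_ + - _]addrC.
have sF d : exists t, s t == d.
  by have [x [y [z <-]]] := fgh_surj d; exists (x, y, z).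
pose F d := xchoose (sF d).
have FK d : s (F d) = d by exact/eqP/(xchooseP (sF d)).
have lF : linear F by move=> k d d'; apply: s_inj; rewrite sP !FK.
pose fL := GRing.isLinear.Build R D (A * B * C)%type _ F lF.
exists (HB.pack_for {linear D -> (A * B * C)%type} F fL).
by exists s => [d|t]; [exact: FK | apply: s_inj; exact: FK].
Qed.

Section BarClasses.
Variables (R : nzRingType) (G : groupType) (n : nat).
Implicit Types c d : bar_chain R G n.+1.

Definition bar_class c (c0 : bar_diff c = 0) : group_homology R G n.+1 :=
  hclass (@bar_diff R G n.+1) c0.

Lemma bar_classP (x : group_homology R G n.+1) :
  exists c (c0 : bar_diff c = 0), x = bar_class c0.
Proof. exact: hclassP. Qed.

Lemma eq_bar_class c d (c0 : bar_diff c = 0) (d0 : bar_diff d = 0) :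
  bar_class c0 = bar_class d0 <-> exists y, bar_diff y = c - d.
Proof. exact: eq_hclass. Qed.

Lemma bar_cycleD c d : bar_diff c = 0 -> bar_diff d = 0 -> bar_diff (c + d) = 0.
Proof. by move=> c0 d0; rewrite linearD /= c0 d0 addr0. Qed.

Lemma bar_classD c d (c0 : bar_diff c = 0) (d0 : bar_diff d = 0) :
  bar_class c0 + bar_class d0 = bar_class (bar_cycleD c0 d0).
Proof.
have cd0 : bar_diff (1 *: c + d) = 0 by rewrite scale1r bar_cycleD.
rewrite -[bar_class c0]scale1r [LHS](hclass_linear _ _ _ cd0).
by apply/eq_hclass; exists 0; rewrite linear0 scale1r subrr.
Qed.

Lemma bar_class_eq0 c (c0 : bar_diff c = 0) :
  bar_class c0 = 0 <-> exists y, bar_diff y = c.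
Proof.
have zero0 : bar_diff (0 : bar_chain R G n.+1) = 0 by rewrite linear0.
have -> : 0 = bar_class zero0.
  apply: (@addrI _ (bar_class zero0)); rewrite addr0 bar_classD.
  by apply/eq_bar_class; exists 0; rewrite linear0 addr0 subrr.
by rewrite eq_bar_class subr0.
Qed.
End BarClasses.

Section BarHomologyMap.
Variables (R : fieldType) (H G : groupType) (phi : H -> G).
Hypothesis phiM : {morph phi : x y / (x * y)%g}.

Lemma bar_map_cycle n (c : bar_chain R H n.+1) :
  bar_diff c = 0 -> bar_diff (bar_map phi c) = 0.
Proof. by rewrite bar_map_diff // => ->; rewrite linear0. Qed.

Lemma bar_map_boundary n (c : bar_chain R H n.+1) :
  exists c', bar_diff c' = bar_map phi (bar_diff c).
Proof. by exists (bar_map phi c); rewrite bar_map_diff. Qed.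

Definition group_homology_map n :
    group_homology R H n.+1 -> group_homology R G n.+1 :=
  homology_map (@bar_map R H G phi n.+1) (@bar_map_cycle n).

Lemma group_homology_map_linear n : linear (@group_homology_map n).
Proof. exact: homology_map_linear (@bar_map_boundary n.+1). Qed.

HB.instance Definition _ n := GRing.isLinear.Build R
  (group_homology R H n.+1) (group_homology R G n.+1) _ (@group_homology_map n)
  (@group_homology_map_linear n).

Lemma group_homology_mapE n c (c0 : @bar_diff R H n c = 0) :
  group_homology_map (bar_class c0) = bar_class (bar_map_cycle c0).
Proof. exact: homology_map_class (@bar_map_boundary n.+1) _ _ _. Qed.
End BarHomologyMap.

Section DihedralSubgroups.
Variables (R : fieldType) (G : groupType) (m : nat) (x y : G).
Hypothesis m_gt1 : (1 < m)%N.
Hypothesis dxy : dihedral_pair m x y.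
Notation aug2 := (aug (R := R) (fun g => x = g \/ y = g)).

Lemma aug_alt_word w (s : seq G) :
  fsing (lmuls (alt_word x y w) s) - fsing s \in aug2.
Proof.
elim: w => [|e w IH] /=; first by rewrite lmuls1 subrr rpred0.
rewrite -[X in X - _](subrK (fsing (lmuls (alt_word x y w) s))) -addrA rpredD //.
by rewrite lmulsM aug_sing //; case: e; [left | right].
Qed.

Lemma dihedral_embedding : exists phi : dihedral_group m -> G,
  [/\ {morph phi : g h / (g * h)%g}, injective phi,
      forall g, x = g \/ y = g -> exists h, g = phi h &
      forall h, exists w, phi h = alt_word x y w].
Proof.
have [s [t [dst gen_st]]] := dihedral_group_pair m_gt1.
have [phi [phiM phi_inj phis phit]] :=
  dihedral_pair_embedding (ltnW m_gt1) dst dxy gen_st.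
exists phi; split=> // [g [<-|<-]|h]; [by exists s | by exists t |].
have [w ->] := gen_st h; exists w; elim: w => [|e w IH] /=; first exact: mul_morph1.
by rewrite phiM IH; case: e; rewrite ?phis ?phit.
Qed.

(** What the comparison of the bar complex of a dihedral subgroup with ordered
    chains on G provides: cycles are sent to cycles modulo the subgroup, only
    boundaries become boundaries, and every cycle modulo the subgroup is reached. *)
Lemma dihedral_retraction n : exists phi : dihedral_group m -> G,
  {morph phi : g h / (g * h)%g} /\
  [/\ forall c : bar_chain R (dihedral_group m) n.+1, bar_diff c = 0 ->
        bdry (smap phi (homog c)) \in aug2,
      forall (c : bar_chain R (dihedral_group m) n.+1) u,
        smap phi (homog c) - bdry u \in aug2 -> exists w, bar_diff w = c &
      forall z, bdry z \in aug2 -> exists c, bar_diff c = 0 /\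
        exists y, inhomog n.+1 z - bar_map phi c = bar_diff y].
Proof.
have [phi [phiM phi_inj S_phi phi_word]] := dihedral_embedding.
have [rho [rhoM rhoK]] := equivariant_retraction phiM phi_inj.
exists phi; split=> //; split=> [c|c u|z].
- apply: smap_homog_cycle => // h s; have [w ->] := phi_word h; exact: aug_alt_word.
- move=> /(retract_aug S_phi rhoM n.+1); rewrite !linearB /= retract_homog //.
  rewrite -bdry_smap inhomog_bdry => /subr0_eq ->.
  by exists (inhomog n.+2 (smap rho u)).
- move=> zS; exists (inhomog n.+1 (smap rho z)); split.
    by rewrite -inhomog_bdry bdry_smap; exact: retract_aug S_phi rhoM _ _ zS.
  exact: (inhomog_retract phiM S_phi rhoM).
Qed.
End DihedralSubgroups.

(** * Homology of triangle groups *)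

Section TriangleGroup.
Variables (p q r : nat).
Hypotheses (p_gt1 : (1 < p)%N) (q_gt1 : (1 < q)%N) (r_gt1 : (1 < r)%N).
Notation grp := (triangle_group p q r).
Notation rels := (triangle_rels p q r).
Notation a := (ga p q r).
Notation b := (gb p q r).
Notation c := (gc p q r).

Lemma triangle_group_ind (P : grp -> Prop) : P 1%g ->
  (forall g, P g -> [/\ P (a * g)%g, P (b * g)%g & P (c * g)%g]) ->
  forall g, P g.
Proof.
move=> P1 PM g; rewrite -(word_val_repr g).
elim: (repr g) => [|[i e] w /PM[Pa Pb Pc]] //=.
rewrite word_val_cons; last exact: gen_invol.
by case: (letter3 i) => ->.
Qed.

Lemma gen_pair_neq i j k : ((gen rels i * gen rels j) ^+ k <> gen rels i)%g.
Proof.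
rewrite word_val_pair_exp => /word_val_parity; rewrite /word_exp.
elim: k => [|k IH] //=.
by rewrite negbK.
Qed.

Lemma triangle_dihedral_pairs :
  [/\ dihedral_pair p a b, dihedral_pair q b c & dihedral_pair r c a].
Proof.
have [abp bcq car] := triangle_rotations p q r.
have ordP (x y : grp) m k : ((x * y) ^+ m = 1)%g ->
    (((x * y) ^+ k = 1)%g -> (m %| k)%N) ->
    ((x * y) ^+ k = 1)%g <-> (m %| k)%N.
  by move=> xym ordxy; split=> // /dvdnP[d ->]; rewrite mulnC expgM xym expg1n.
split; split; rewrite ?gaa ?gbb ?gcc //; try (by move=> k; exact: gen_pair_neq);
  by move=> k; apply: ordP => //; have [] := triangle_orders p_gt1 q_gt1 r_gt1 k.
Qed.

Definition sign (g : grp) : rat := (-1) ^+ odd (size (repr g)).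

Lemma sign_gen i g : sign (gen rels i * g)%g = - sign g.
Proof.
rewrite /sign; have -> : odd (size (repr (gen rels i * g)%g)) = ~~ odd (size (repr g)).
  rewrite -[RHS]/(odd (size ((i, false) :: repr g))); apply: (@word_val_parity p q r).
  by rewrite word_val_cons ?word_val_repr //; exact: gen_invol.
by case: odd; rewrite ?expr1 ?expr0 ?opprK.
Qed.

Lemma rank_dihedral (s : seq grp) (s_all : forall g, g \in s) m (x y : grp) :
  uniq s -> (1 < m)%N -> dihedral_pair m x y ->
  (\rank (diff_mx s_all x :&: diff_mx s_all y)%MS * m.*2 <= size s)%N.
Proof.
move=> s_uniq m_gt1 dxy; have [xx yy _ _] := dxy.
have [phi [phiM phi_inj _ phi_word]] := dihedral_embedding m_gt1 dxy.
have := rank_orbit s_uniq s_all xx yy phiM phi_inj phi_word.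
by rewrite -cardsT card_dihedral.
Qed.

Hypothesis pqr_le1 : p%:R^-1 + q%:R^-1 + r%:R^-1 <= 1 :> rat.

Theorem triangle_group_infinite (s : seq grp) : exists g, g \notin s.
Proof.
apply: contrapT => s_full; have s_all g : g \in undup s.
  by rewrite mem_undup; apply/negPn/negP => gs; apply: s_full; exists g.
have [dab dbc dca] := triangle_dihedral_pairs.
have := pqr_le1; rewrite leNgt => /negP; apply.
apply: (@finite_triangle_excess _ _ (undup_uniq s) s_all a b c sign).
- exact: gaa.
- exact: gbb.
- exact: gcc.
- exact: coxeter_triangle_exact.
- by move=> x; rewrite signr_eq0.
- exact: (sign_gen (inord 0)).
- exact: (sign_gen (inord 1)).
- exact: (sign_gen (inord 2)).
- exact: ltnW p_gt1.
- exact: ltnW q_gt1.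
- exact: ltnW r_gt1.
- by apply: rank_dihedral => //; exact: undup_uniq.
- by apply: rank_dihedral => //; exact: undup_uniq.
- by apply: rank_dihedral => //; exact: undup_uniq.
Qed.

Variable R : fieldType.
Hypothesis two_neq0 : 2%:R != 0 :> R.
Notation aug1 x := (aug (R := R) (eq (x : grp))).

(** Each generator negates m, so the support of m is stable under G; the first
    entries of its nonempty members would exhaust G, which is infinite.  On the empty
    sequence G acts trivially, and the coefficient equals its own opposite. *)
Theorem triangle_aug_inj (m : {freeg (seq grp) / R}) :
  m \in aug1 a -> m \in aug1 b -> m \in aug1 c -> m = 0.
Proof.
move=> am bm cm.
have anti i : trans (gen rels i) m = - m.
  by case: (letter3 i) => ->; apply: aug_anti => //; exact: gen_invol.
have coeff_trans (g : grp) s : coeff (lmuls g s) (trans g m) = coeff s m.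
  elim/freeg_span: m {am bm cm anti} => [|k t m IH]; first by rewrite linear0 !coeff0.
  rewrite linearP /= !coeffD !coeffZ IH trans_sing !coeffU !mul1r.
  by rewrite (inj_eq (inj_map (@mulgI _ g))).
have coeff_gen i s : coeff (lmuls (gen rels i) s) m = - coeff s m.
  by rewrite -[in LHS](opprK m) coeffN -(anti i) coeff_trans.
apply/eqP/freeg_eqP => s; rewrite coeff0; apply/eqP/negPn/negP => ms.
case: s ms => [|x s] ms.
  have /eqP := coeff_gen (inord 0) [::]; rewrite -subr_eq0 opprK -mulr2n.
  by rewrite -mulr_natl mulf_eq0 (negbTE two_neq0) (negbTE ms).
have [g] := triangle_group_infinite [seq head 1%g t | t <- freeg.dom m].
case/negP; rewrite -(mulgVK x g).
apply: (@map_f _ _ (head 1%g) _ (lmuls (g * x^-1)%g (x :: s))).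
rewrite mem_dom; elim/triangle_group_ind: (g * x^-1)%g => [|h IH].
  by rewrite lmuls1.
by rewrite !lmulsM !coeff_gen !oppr_eq0.
Qed.

Lemma triangle_generated (g : grp) s :
  fsing (lmuls g s) - fsing s \in aug (R := R) (fun g => (a = g \/ b = g) \/ c = g).
Proof.
elim/triangle_group_ind: g => [|g IH]; first by rewrite lmuls1 subrr rpred0.
have stepS x : (a = x \/ b = x) \/ c = x ->
    fsing (lmuls (x * g)%g s) - fsing s \in
      aug (R := R) (fun g => (a = g \/ b = g) \/ c = g).
  move=> Sx; rewrite lmulsM -[X in X - _](subrK (fsing (lmuls g s))) -addrA.
  by rewrite rpredD // aug_sing.
by split; apply: stepS; auto.
Qed.

(** Both halves go through ordered chains on G: [boundary_split] gives
    injectivity and [cycle_split] surjectivity of the sum of the three maps induced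
    by the inclusions of the dihedral subgroups. *)
Theorem triangle_homology n : exists f :
  {linear group_homology R grp n.+1 ->
    (group_homology R (dihedral_group p) n.+1 *
     group_homology R (dihedral_group q) n.+1 *
     group_homology R (dihedral_group r) n.+1)%type}, bijective f.
Proof.
have [dab dbc dca] := triangle_dihedral_pairs.
have [phi1 [phi1M [cyc1 bdr1 sur1]]] := dihedral_retraction R p_gt1 dab n.
have [phi2 [phi2M [cyc2 bdr2 sur2]]] := dihedral_retraction R q_gt1 dbc n.
have [phi3 [phi3M [cyc3 bdr3 sur3]]] := dihedral_retraction R r_gt1 dca n.
apply: (linear_inverse3 (f := @group_homology_map R _ _ _ phi1M n)
  (g := @group_homology_map R _ _ _ phi2M n)
  (h := @group_homology_map R _ _ _ phi3M n)) => [x1 x2 x3|y].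
  have [c1 [z1 ->]] := bar_classP x1; have [c2 [z2 ->]] := bar_classP x2.
  have [c3 [z3 ->]] := bar_classP x3.
  rewrite -[LHS]/(group_homology_map phi1M (bar_class z1) +
    group_homology_map phi2M (bar_class z2) + group_homology_map phi3M (bar_class z3)).
  rewrite !group_homology_mapE !bar_classD => /bar_class_eq0[y yE].
  have homog_sub (H : groupType) (phi : H -> grp) (phiM : {morph phi : x y / (x * y)%g})
      (d : bar_chain R H n.+1) :
      smap phi (homog d) - homog (bar_map phi d) \in aug (R := R) (fun _ : grp => True).
    by rewrite -rpredN opprB; exact: homog_bar_map.
  have := @boundary_split R grp a b c two_neq0 (gaa p q r) (gbb p q r) (gcc p q r)
    (@coxeter_triangle_exact R p q r) triangle_aug_inj triangle_generated
    _ _ _ (homog y) (cyc1 _ z1) (cyc2 _ z2) (cyc3 _ z3).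
  case=> [|u [v [w [/bdr1[w1 E1] /bdr2[w2 E2] /bdr3[w3 E3]]]]].
    set s1 := smap phi1 _; set s2 := smap phi2 _; set s3 := smap phi3 _.
    have -> : s1 + s2 + s3 - bdry (homog y) =
        (s1 - homog (bar_map phi1 c1)) + (s2 - homog (bar_map phi2 c2)) +
        (s3 - homog (bar_map phi3 c3)) - (bdry (homog y) - homog (bar_diff y)).
      by rewrite yE !linearD /=; freeg_ring.
    by rewrite rpredB ?homog_bdry // rpredD ?homog_sub // rpredD ?homog_sub.
  have b1 : bar_class z1 = 0 by apply/bar_class_eq0; exists w1.
  have b2 : bar_class z2 = 0 by apply/bar_class_eq0; exists w2.
  have b3 : bar_class z3 = 0 by apply/bar_class_eq0; exists w3.
  by split.
have [d [dz ->]] := bar_classP y.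
have dT : bdry (homog d) \in aug (R := R) (fun _ : grp => True).
  by have := homog_bdry d; rewrite dz linear0 subr0.
have [u [v [w [/sur1[c1 [z1 [y1 E1]]] /sur2[c2 [z2 [y2 E2]]] /sur3[c3 [z3 [y3 E3]]] dE]]]] :=
  @cycle_split R grp a b c two_neq0 (gaa p q r) (gbb p q r) (gcc p q r)
    (@coxeter_triangle_exact R p q r) triangle_aug_inj triangle_generated
    (homog d) dT.
exists (bar_class z1), (bar_class z2), (bar_class z3).
rewrite -[LHS]/(group_homology_map phi1M (bar_class z1) +
  group_homology_map phi2M (bar_class z2) + group_homology_map phi3M (bar_class z3)).
rewrite !group_homology_mapE !bar_classD.
apply/eq_bar_class; exists (- (y1 + y2 + y3)).
rewrite linearN !linearD /= -E1 -E2 -E3 -[d]homogK dE !linearD /=.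
freeg_ring.
Qed.
End TriangleGroup.

Close Scope ring_scope.

Theorem proposition14 (p q r l n : nat)
    (p_ge2 : 2 <= p) (q_ge2 : 2 <= q) (r_ge2 : 2 <= r)
    (pqr_le1 : ((p%:R^-1 + q%:R^-1 + r%:R^-1 : rat) <= 1)%R)
    (l_prime : prime l) (l_gt2 : 2 < l) (n_gt0 : 0 < n) :
  exists f : {linear group_homology 'F_l (triangle_group p q r) n ->
                     (group_homology 'F_l (dihedral_group p) n *
                      group_homology 'F_l (dihedral_group q) n *
                      group_homology 'F_l (dihedral_group r) n)%type},
    bijective f.
Proof.
case: n n_gt0 => // n _; apply: triangle_homology => //.
by rewrite -(dvdn_pcharf (pchar_Fp l_prime)) gtnNdvd.
Qed.
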